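(* Let $1<p<\infty$, let $k,n\ge 1$ be integers, and let $\mathcal{G}=\{\mathcal{G}_i^j\}_{1\le i\le n,\,1\le j\le k}$ be a family of sub-$\sigma$-algebras of $\mathcal{F}$ such that $\mathcal{G}_1^j\subseteq\mathcal{G}_2^j\subseteq\cdots\subseteq\mathcal{G}_n^j$ for each $j\in\{1,\dots,k\}$ (no relation between $\sigma$-algebras with different $j$ is imposed). Then for any random variable $\xi\in L^p(\Omega,\mathcal{F},\mathbb{P})$, $$\|M_{\mathcal{G}}\xi\|_p\le C_{p,k}\|\xi\|_p,$$ where $C_{p,k}$ is the unique root in $[1,\infty)$ of the equation $$(p-1)C_{p,k}^p-pC_{p,k}^{p-1}-(k-1)=0.$$ Moreover, for fixed $1<p<\infty$ and $k\ge 1$ the constant $C_{p,k}$ is the best possible: given $\varepsilon>0$, there exist an integer $n\ge 1$, a family $\mathcal{G}=\{\mathcal{G}_i^j\}_{1\le i\le n,\,1\le j\le k}$ of sub-$\sigma$-algebras with $\mathcal{G}_1^j\subseteq\cdots\subseteq\mathcal{G}_n^j$ for each $j$, and a random variable $\xi\in L^p$ for which $$\|M_{\mathcal{G}}\xi\|_p>(C_{p,k}-\varepsilon)\|\xi\|_p.$$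
   Context: $(\Omega,\mathcal{F},\mathbb{P})$ is an arbitrary nonatomic probability space. For an integrable random variable $\xi$ and a finite family $\mathcal{G}=\{\mathcal{G}_i^j\}_{1\le i\le n,\,1\le j\le k}$ of sub-$\sigma$-algebras of $\mathcal{F}$, the associated maximal function is $M_{\mathcal{G}}\xi=\max_{1\le i\le n,\,1\le j\le k}|\mathbb{E}(\xi|\mathcal{G}_i^j)|$. $\|\cdot\|_p$ denotes the $L^p$ norm. *)

(* Defs.v *)
From HB Require Import structures.
From mathcomp Require Import all_boot all_order all_algebra.
From mathcomp Require Import all_classical all_reals all_analysis.
From mathcomp Require Import measurable_realfun.

Set Implicit Arguments.
Unset Strict Implicit.
Unset Printing Implicit Defensive.

Import Order.TTheory GRing.Theory Num.Theory.
Import numFieldNormedType.Exports.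

Local Open Scope classical_set_scope.
Local Open Scope ring_scope.

Definition nonatomic d (T : measurableType d) (R : realType)
    (P : probability T R) : Prop :=
  forall A : set T, measurable A -> (0 < P A)%E ->
    exists B : set T,
      [/\ measurable B, B `<=` A, (0 < P B)%E & (P B < P A)%E].

Definition is_sub_sigma_algebra d (T : measurableType d)
    (G : set_system T) : Prop :=
  sigma_algebra [set: T] G /\ G `<=` measurable.

(* [Y] is a version of E(X | G).  For a sigma-algebra [G], the measurable sets
   of [g_sigma_algebraType G] are exactly the members of [G]. *)
Definition is_condexp d (T : measurableType d) (R : realType)
    (P : probability T R) (G : set_system T) (X Y : T -> R) : Prop :=
  [/\ measurable_fun [set: g_sigma_algebraType G] Y,
      P.-integrable [set: T] (EFin \o Y) &
      forall A, G A ->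
        (\int[P]_(w in A) (Y w)%:E = \int[P]_(w in A) (X w)%:E)%E].

Lemma is_condexp_exists d (T : measurableType d) (R : realType)
    (P : probability T R) (G : set_system T) (X : T -> R) :
  is_sub_sigma_algebra G -> P.-integrable [set: T] (EFin \o X) ->
  exists Y : T -> R, is_condexp P G X Y.
Proof.
move=> [sG Gm] intX.
pose S : measurableType _ := g_sigma_algebraType G.
have mG (A : set S) : measurable A = G A.
  by rewrite -[in RHS](sigma_algebra_id sG).
pose i : T -> S := id.
have mi : measurable_fun [set: T] i.
  by move=> _ A; rewrite mG => GA; rewrite setTI; exact: Gm.
pose mu0 : {measure set S -> \bar R} :=
  measure_function_pushforward__canonical__measure_function_Measure P mi.
have mufin : fin_num_fun mu0.
  by move=> A; rewrite mG => GA; apply: fin_num_measure; exact: Gm.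
pose mu : {finite_measure set S -> \bar R} :=
  HB.pack (mu0 : set S -> \bar R) (Measure.on mu0)
    (Measure_isFinite.Build _ _ _ mu0 mufin).
pose nu : {charge set S -> \bar R} :=
  measure_function_pushforward__canonical__charge_Charge
    (induced_charge intX) mi.
have numu : nu `<< mu.
  apply/null_content_dominatesP => A; rewrite mG => GA PA0.
  have mX : measurable_fun [set: T] (EFin \o X) := measurable_int P intX.
  have mA : d.-measurable (i @^-1` A) by exact: Gm.
  apply: null_set_integral mA _ PA0.
  exact: measurable_funS mX.
pose f : S -> \bar R := Radon_Nikodym nu mu.
have ffin x : f x \is a fin_num by exact: Radon_Nikodym_fin_num.
have intf : mu.-integrable [set: S] f by exact: Radon_Nikodym_integrable.
have mf : measurable_fun [set: S] f := measurable_int mu intf.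
have Pf : P.-integrable [set: T] f.
  apply/integrableP; split; first exact: (measurableT_comp mf mi).
  have /integrableP[_] := intf.
  rewrite (@ge0_integral_pushforward _ _ T S R i mi P setT (abse \o f))//.
    exact: measurableT_comp.
  by move=> y _; exact: abse_ge0.
have fE : EFin \o (fine \o f) = f by apply/funext => x /=; rewrite fineK.
exists (fine \o f); split; first exact: measurableT_comp.
  by rewrite fE.
move=> A GA; have mA : measurable (A : set S) by rewrite mG.
have <- : nu A = (\int[P]_(w in A) (X w)%:E)%E by [].
rewrite (Radon_Nikodym_integral numu mA).
rewrite (@integral_pushforward _ _ T S R i mi P A f mf)//.
  by apply: eq_integral => x _ /=; rewrite fineK.
by apply: integrableS Pf => //; exact: Gm.
Qed.

Definition condexp d (T : measurableType d) (R : realType)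
    (P : probability T R) (G : set_system T) (X : T -> R) : T -> R :=
  get [set Y | is_condexp P G X Y].

Lemma condexpP d (T : measurableType d) (R : realType)
    (P : probability T R) (G : set_system T) (X : T -> R) :
  is_sub_sigma_algebra G -> P.-integrable [set: T] (EFin \o X) ->
  is_condexp P G X (condexp P G X).
Proof.
by move=> sG /(is_condexp_exists sG)[Y XY]; exact: (getI XY).
Qed.

Definition filtration_family d (T : measurableType d) (n k : nat)
    (G : 'I_n -> 'I_k -> set_system T) : Prop :=
  (forall i j, is_sub_sigma_algebra (G i j)) /\
  (forall j (i1 i2 : 'I_n), (i1 <= i2)%N -> G i1 j `<=` G i2 j).

(* The default value 0 of the iterated maximum is harmless, since the terms are
   nonnegative. *)
Definition maximal_function d (T : measurableType d) (R : realType)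
    (P : probability T R) (n k : nat) (G : 'I_n -> 'I_k -> set_system T)
    (xi : T -> R) (w : T) : R :=
  \big[Num.max/0]_(i < n) \big[Num.max/0]_(j < k) `|condexp P (G i j) xi w|.

(* Main.v *)
Require Import Defs.
From mathcomp Require Import all_boot all_order all_algebra.
From mathcomp Require Import all_classical all_reals all_analysis.
From mathcomp Require Import measurable_realfun.
From mathcomp Require Import ring lra.

Set Implicit Arguments.
Unset Strict Implicit.
Unset Printing Implicit Defensive.

Import Order.TTheory GRing.Theory Num.Theory.
Import numFieldNormedType.Exports.

Local Open Scope classical_set_scope.
Local Open Scope ring_scope.

(** Upper bound.  For a single filtration, let N be the running maximum of
    |E(xi | G_i)|, truncated at a level L so that every integral below is
    finite.  N grows at time i only if it then equals the (truncated) current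
    value, and the increment of N^(p-1) at time i is G_i-measurable, so
    testing E(xi | G_i) against these increments and summing gives Doob's
    inequality in the form (p-1) E N^p <= p E(|xi| N^(p-1))
    ([doob_truncated]).  Now take k filtrations, with maxima N_1, ..., N_k.
    The function m |-> (p-1) m^p - p x m^(p-1) has its minimum -x^p at m = x;
    this is Young's inequality.  Add the k Doob inequalities and, at each
    point, keep the term of an index j for which N_j is largest, bounding the
    k-1 other terms below by -|xi|^p:
      (p-1) E M^p <= p E(|xi| M^(p-1)) + (k-1) E |xi|^p.
    One more use of Young's inequality, with x = C |xi|, bounds the middle
    term; the equation for C is what makes the resulting constant equal to C^p
    ([max_pathwise], [max_integral_le]).  Finally L tends to infinity.

    Sharpness.  For equality, at each point one of the N_j should be C xi and
    the others equal to xi, while each filtration is extremal for Doob's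
    inequality.  So split the space into k columns of equal mass, let
    xi have tail proportional to x^(-p) on each of them, and let the j-th
    filtration have, when xi is explored up to x, one unexplored atom, namely
    {xi >= x} in column j together with {xi >= C x} in the other columns.  The
    equation for C says that the mean of xi on this atom is C x, which is then
    the value of the conditional expectation there.  In the discrete version
    xi takes the values q^m with q^s = C, and the mean is only bounded below by
    (C/q) q^m ([atom_mean_ge]).  With the exponent p every level contributes
    the same amount to E xi^p, so the finitely many levels on which the bound
    is not available do not matter when the number of levels is large; then q
    tends to 1.  Sets of the prescribed masses exist because a nonatomic
    probability takes all intermediate values
    ([nonatomic_intermediate]). *)

(** * Young's inequality and the extremal constant *)

(** This is the inequality ab <= a^p / p + b^q / q with conjugate exponents, for
    b^(p-1) in place of b and multiplied by p; the form with b^p on the right is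
    the one that telescopes along a running maximum. *)
Lemma young_powR (R : realType) (p a b : R) :
  1 < p -> 0 <= a -> 0 <= b ->
  p * (a * b `^ (p - 1)) <= (p - 1) * b `^ p + a `^ p.
Proof.
move=> p1 a0 b0; have p0 : 0 < p by lra.
have pB0 : 0 < p - 1 by lra.
have := @conjugate_powR R a (b `^ (p - 1)) p (p / (p - 1)) a0 (powR_ge0 _ _).
rewrite -powRrM [(p - 1) * _]mulrC divfK ?gt_eqF// => H.
have q0 : 0 < p / (p - 1) by rewrite divr_gt0.
have pq : p^-1 + (p / (p - 1))^-1 = 1 by field; rewrite !gt_eqF.
move: (H p0 q0 pq); rewrite -(ler_pM2l p0) => /le_trans; apply.
rewrite le_eqVlt; apply/orP; left; apply/eqP.
by field; rewrite !gt_eqF.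
Qed.

(** The equation reads c^(p-1) ((p-1) c - p) = K.  As K >= 0, a root makes the
    second factor nonnegative, and from there on both factors increase. *)
Lemma extremal_root_unique (R : realType) (p K c c' : R) : 1 < p -> 0 <= K ->
  1 <= c -> 1 <= c' ->
  (p - 1) * c `^ p - p * c `^ (p - 1) - K = 0 ->
  (p - 1) * c' `^ p - p * c' `^ (p - 1) - K = 0 -> c = c'.
Proof.
move=> p1 K0.
have key x : 1 <= x -> (p - 1) * x `^ p - p * x `^ (p - 1) - K = 0 ->
    [/\ 0 < x `^ (p - 1), p <= (p - 1) * x &
        x `^ (p - 1) * ((p - 1) * x - p) = K].
  move=> x1 E; have x0 : 0 < x by lra.
  have q0 : 0 < x `^ (p - 1) by exact: powR_gt0.
  have E' : x `^ (p - 1) * ((p - 1) * x - p) = K.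
    rewrite -(@mulr_powRB1 _ x p) in E; [nra|lra|lra].
  split=> //; rewrite -subr_ge0.
  by rewrite -(pmulr_rge0 _ q0) E'.
have lt_root x y : 1 <= x -> 1 <= y -> x < y ->
    (p - 1) * x `^ p - p * x `^ (p - 1) - K = 0 ->
    (p - 1) * y `^ p - p * y `^ (p - 1) - K = 0 -> False.
  move=> x1 y1 xy /(key _ x1)[X0 X1 XE] /(key _ y1)[Y0 Y1 YE].
  have XY : x `^ (p - 1) <= y `^ (p - 1).
    by apply: ge0_ler_powR; rewrite ?nnegrE; lra.
  have : x `^ (p - 1) * ((p - 1) * x - p) < y `^ (p - 1) * ((p - 1) * y - p).
    apply: (@le_lt_trans _ _ (y `^ (p - 1) * ((p - 1) * x - p))).
      by rewrite ler_wpM2r// subr_ge0.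
    by rewrite ltr_pM2l// ltrD2r ltr_pM2l//; lra.
  by rewrite XE YE ltxx.
move=> c1 c1' E E'; apply/eqP; rewrite eq_le !leNgt; apply/andP; split;
  apply/negP => h; [exact: (lt_root c' c)|exact: (lt_root c c')].
Qed.

Lemma extremal_root_exists (R : realType) (p K : R) : 1 < p -> 0 <= K ->
  exists2 c : R, 1 <= c & (p - 1) * c `^ p - p * c `^ (p - 1) - K = 0.
Proof.
move=> p1 K0.
(* At this b the factor (p-1) b - p equals K + 1. *)
pose b := (p + K + 1) / (p - 1).
have b1 : 1 <= b by rewrite ler_pdivlMr; lra.
pose f (x : R) := (p - 1) * x `^ p - p * x `^ (p - 1).
have fcont : {within `[1, b], continuous f}.
  apply: derivable_within_continuous => x; rewrite in_itv/= => /andP[x1 _].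
  have x0 : x \in `]0, +oo[ by rewrite in_itv/= andbT; lra.
  by apply: derivableB; apply: derivableM => //; exact: derivable_powR.
have f1 : f 1 = -1 by rewrite /f !powR1; lra.
have fb : K <= f b.
  have b0 : 0 <= b by lra.
  rewrite /f -(@mulr_powRB1 _ b p) //; last by lra.
  have -> : (p - 1) * (b * b `^ (p - 1)) - p * b `^ (p - 1) =
            (K + 1) * b `^ (p - 1).
    by rewrite /b; field; lra.
  have : 1 <= b `^ (p - 1).
    have := @ler_powR _ b b1 0 (p - 1); rewrite powRr0; apply; lra.
  nra.
have [|c /itvP cI cE] := @IVT R f 1 b K b1 fcont.
  by rewrite f1 ge_min le_max fb orbT andbT; apply/orP; left; lra.
by exists c; [rewrite cI|rewrite -/(f c) cE subrr].
Qed.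

Lemma extremal_root_gt1 (R : realType) (p C : R) (k : nat) : (1 <= k)%N ->
  1 <= C -> (p - 1) * C `^ p - p * C `^ (p - 1) - (k%:R - 1) = 0 -> 1 < C.
Proof.
move=> k1; rewrite le_eqVlt => /predU1P[<-|//]; rewrite !powR1.
have : (1 : R) <= k%:R by rewrite ler1n.
lra.
Qed.

(** * Weights measurable for a sub-sigma-algebra *)

Lemma measurable_g_sigmaE (T : pointedType) (G : set_system T)
    (A : set (g_sigma_algebraType G)) :
  sigma_algebra [set: T] G -> measurable A = G A.
Proof. by move=> sG; rewrite -[in RHS](sigma_algebra_id sG). Qed.

Lemma sub_sigma_measurable_fun d (T : measurableType d) d'
    (U : measurableType d') (G : set_system T) (f : T -> U) :
  is_sub_sigma_algebra G -> measurable_fun [set: g_sigma_algebraType G] f ->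
  measurable_fun [set: T] f.
Proof.
move=> [sG Gm] mf _ B mB; apply: Gm.
by have := mf measurableT B mB; rewrite measurable_g_sigmaE.
Qed.

Lemma finer_sigma_measurable_fun d (T : measurableType d) d'
    (U : measurableType d') (G1 G2 : set_system T) (f : T -> U) :
  sigma_algebra [set: T] G1 -> sigma_algebra [set: T] G2 -> G1 `<=` G2 ->
  measurable_fun [set: g_sigma_algebraType G1] f ->
  measurable_fun [set: g_sigma_algebraType G2] f.
Proof.
move=> s1 s2 G12 mf _ B mB; rewrite measurable_g_sigmaE//; apply: G12.
by have := mf measurableT B mB; rewrite measurable_g_sigmaE.
Qed.

(** A comparison of the integrals of U and V over all sets of G extends to all
    nonnegative G-measurable weights: it passes to nonnegative combinations of
    indicators, then to monotone limits. *)
Section weighted_comparison.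
Context d (T : measurableType d) (R : realType) (P : probability T R).
Variables (G : set_system T) (U V : T -> R).
Hypothesis sG : is_sub_sigma_algebra G.
Hypothesis mU : measurable_fun [set: T] U.
Hypothesis mV : measurable_fun [set: T] V.
Hypothesis U0 : forall w, 0 <= U w.
Hypothesis V0 : forall w, 0 <= V w.
Hypothesis UV : forall A, G A ->
  (\int[P]_(w in A) (U w)%:E <= \int[P]_(w in A) (V w)%:E)%E.

Import HBNNSimple.

Let nnsfun_integral (Z : T -> R) (h : {nnsfun (g_sigma_algebraType G) >-> R}) :
  measurable_fun [set: T] Z -> (forall w, 0 <= Z w) ->
  (\int[P]_w (h w * Z w)%:E =
   \sum_(r \in range h) r%:E * \int[P]_(w in h @^-1` [set r]) (Z w)%:E)%E.
Proof.
move=> mZ Z0; have [_ Gm] := sG.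
have mh r : d.-measurable (h @^-1` [set r]).
  apply: Gm; rewrite -measurable_g_sigmaE; last by case: sG.
  exact: measurable_sfunP.
have ge0 r w : (0 <= (Z w)%:E * (r * \1_(h @^-1` [set r]) w)%:E)%E.
  by apply: mule_ge0; rewrite ?EFinM ?nnfun_muleindic_ge0// lee_fin.
transitivity (\int[P]_w (\sum_(r \in range h)
    ((Z w)%:E * (r * \1_(h @^-1` [set r]) w)%:E)))%E.
  apply: eq_integral => w _; rewrite mulrC EFinM {1}fimfunE -fsumEFin//.
  by rewrite ge0_mule_fsumr// => r; rewrite EFinM nnfun_muleindic_ge0.
rewrite ge0_integral_fsum//; last first.
  move=> r; apply: emeasurable_funM; first exact/measurable_EFinP.
  apply/measurable_EFinP; exact: measurable_funM.
apply: eq_fsbigr => r /set_mem[x _ <-].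
rewrite [in RHS]integral_mkcond -ge0_integralZl_EFin//.
- apply: eq_integral => w _; rewrite /patch indicE.
  rewrite muleC EFinM -muleA; congr (_ * _)%E.
  by case: ifPn => _; rewrite ?mul1e ?mul0e.
- by move=> w _; rewrite /patch; case: ifPn => // _; rewrite lee_fin.
- apply/(measurable_restrictT _ _).1 => //.
  by apply/measurable_funTS/measurable_EFinP.
Qed.

Let UV_nnsfun (h : {nnsfun (g_sigma_algebraType G) >-> R}) :
  (\int[P]_w (h w * U w)%:E <= \int[P]_w (h w * V w)%:E)%E.
Proof.
rewrite !nnsfun_integral//; apply: lee_fsum => //= r [x _ <-].
apply: lee_wpmul2l; first by rewrite lee_fin.
apply: UV; rewrite -measurable_g_sigmaE; last by case: sG.
exact: measurable_sfunP.
Qed.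

Lemma weighted_integral_le (H : T -> R) :
  measurable_fun [set: g_sigma_algebraType G] H -> (forall w, 0 <= H w) ->
  (\int[P]_w (H w * U w)%:E <= \int[P]_w (H w * V w)%:E)%E.
Proof.
move=> mH H0.
have mEH : measurable_fun [set: g_sigma_algebraType G] (EFin \o H).
  exact/measurable_EFinP.
pose h := nnsfun_approx measurableT mEH.
have hH (w : T) : (h n w)%:E @[n --> \oo] --> (H w)%:E.
  by apply: (@cvg_nnsfun_approx _ _ _ _ measurableT _ mEH) => // x _; rewrite lee_fin.
have ndh (w : T) : {homo (fun n => h n w) : m n / (m <= n)%N >-> m <= n}.
  by move=> m n mn; move: (nd_nnsfun_approx measurableT mEH mn) => /lefP; apply.
have lim (Z : T -> R) : measurable_fun [set: T] Z -> (forall w, 0 <= Z w) ->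
    (\int[P]_w (h n w * Z w)%:E)%E @[n --> \oo] --> (\int[P]_w (H w * Z w)%:E)%E.
  move=> mZ Z0.
  rewrite (_ : (\int[P]_w (H w * Z w)%:E)%E =
      (\int[P]_w limn (fun n => (h n w * Z w)%:E))%E); last first.
    apply: eq_integral => w _; apply/esym/cvg_lim => //.
    rewrite EFinM; under eq_fun do rewrite EFinM.
    by apply: cvgeZr.
  apply: (@cvg_monotone_convergence _ _ _ _ _ _ (fun n (w : T) => (h n w * Z w)%:E)) => //.
  - move=> n; apply/measurable_EFinP; apply: measurable_funM => //.
    by apply: (@sub_sigma_measurable_fun _ _ _ _ G (h n : T -> R) sG).
  - by move=> n w _; rewrite lee_fin mulr_ge0.
  - by move=> w _ m n mn; rewrite lee_fin ler_wpM2r// ndh.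
rewrite -(cvg_lim _ (lim U mU U0))// -(cvg_lim _ (lim V mV V0))//.
apply: lee_lim; [apply/cvg_ex; eexists; exact: lim| |exact: nearW].
by apply/cvg_ex; eexists; exact: lim.
Qed.

End weighted_comparison.

(** * Doob's inequality for one filtration *)

(** Cut A along the sign of Y, which is an event of G; on each part the integral
    of |Y| is plus or minus that of X. *)
Lemma integral_norm_condexp_le d (T : measurableType d) (R : realType)
    (P : probability T R) (G : set_system T) (X Y : T -> R) (A : set T) :
  is_sub_sigma_algebra G -> P.-integrable [set: T] (EFin \o X) ->
  is_condexp P G X Y -> G A ->
  (\int[P]_(w in A) `|Y w|%:E <= \int[P]_(w in A) `|X w|%:E)%E.
Proof.
move=> sG intX [mY intY YX] GA; have [sG' Gm] := sG.
have mYT : measurable_fun [set: T] Y by exact: sub_sigma_measurable_fun sG mY.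
have mXT : measurable_fun [set: T] X.
  exact/measurable_EFinP/(measurable_int P intX).
have mA := Gm _ GA.
pose B : set T := [set w | 0 <= Y w].
have GB : G B.
  rewrite -measurable_g_sigmaE//.
  have := mY measurableT _ (@measurable_itv R `[0, +oo[).
  rewrite setTI; congr (measurable _); apply/seteqP.
  by split=> w /=; rewrite in_itv/= andbT.
have mG (C : set (g_sigma_algebraType G)) : measurable C = G C.
  exact: measurable_g_sigmaE.
have sGI C D : G C -> G D -> G (C `&` D).
  by rewrite -(mG C) -(mG D) -(mG (C `&` D)); exact: measurableI.
have sGD C D : G C -> G D -> G (C `\` D).
  by rewrite -(mG C) -(mG D) -(mG (C `\` D)); exact: measurableD.
have split (Z : T -> R) : measurable_fun [set: T] Z ->
  (\int[P]_(w in A) `|Z w|%:E =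
   \int[P]_(w in A `&` B) `|Z w|%:E + \int[P]_(w in A `\` B) `|Z w|%:E)%E.
  move=> mZ; rewrite -{1}(setUIDK A B) ge0_integral_setU//.
  - by apply: measurableI => //; exact: Gm.
  - by apply: measurableD => //; exact: Gm.
  - apply/measurable_EFinP; apply: measurableT_comp => //.
    exact: measurable_funTS.
  - by apply/disj_setPS => w [[_ ?] [_]].
rewrite !split//; apply: leeD.
- have mC : d.-measurable (A `&` B) by apply: Gm; exact: sGI.
  rewrite (_ : (\int[P]_(w in A `&` B) `|Y w|%:E)%E =
               (\int[P]_(w in A `&` B) (X w)%:E)%E); last first.
    rewrite -YX; last exact: sGI.
    by apply: eq_integral => w /set_mem[_ Y0]; rewrite ger0_norm.
  apply: le_trans (lee_abs _) _.
  apply: le_trans (le_abse_integral _ _ _) _ => //.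
  by apply/measurable_EFinP; exact: measurable_funTS.
- have mC : d.-measurable (A `\` B) by apply: Gm; exact: sGD.
  rewrite (_ : (\int[P]_(w in A `\` B) `|Y w|%:E)%E =
               (- \int[P]_(w in A `\` B) (X w)%:E)%E); last first.
    rewrite -YX; last exact: sGD.
    rewrite -[LHS]oppeK -integral_ge0N//; congr (- _)%E.
    apply: eq_integral => w /set_mem[_ /negP]; rewrite -ltNge => Y0.
    by rewrite ltr0_norm// EFinN oppeK.
  apply: le_trans (lee_abs _) _; rewrite abseN.
  apply: le_trans (le_abse_integral _ _ _) _ => //.
  by apply/measurable_EFinP; exact: measurable_funTS.
Qed.

(** The truncation at L makes all powers of the maximum bounded, so that the
    inequalities below may be subtracted from each other even when the maximum
    is not known to have a finite moment. *)
Fixpoint truncated_max {R : realType} (L : R) (y : nat -> R) (n : nat) : R :=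
  if n is m.+1 then Num.max (truncated_max L y m) (Num.min (y m) L) else 0.

Lemma truncated_max_ge0 (R : realType) (L : R) (y : nat -> R) (n : nat) :
  0 <= truncated_max L y n.
Proof. by elim: n => //= n IH; rewrite le_max IH. Qed.

Lemma truncated_max_le (R : realType) (L : R) (y : nat -> R) (n : nat) :
  0 <= L -> truncated_max L y n <= L.
Proof. by move=> L0; elim: n => //= n IH; rewrite ge_max IH ge_min lexx orbT. Qed.

Lemma le_truncated_max (R : realType) (L : R) (y : nat -> R) (n i : nat) :
  (i < n)%N -> Num.min (y i) L <= truncated_max L y n.
Proof.
elim: n => // n IH; rewrite ltnS leq_eqVlt => /predU1P[->|/IH] /=.
  by rewrite le_max lexx orbT.
by move=> h; rewrite le_max h.
Qed.

(** When the maximum jumps from b to a, the jump time satisfies a <= y i, and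
    Young's inequality bounds (p-1) (a^p - b^p) by p (a^(p-1) - b^(p-1)) a. *)
Lemma truncated_max_pathwise (R : realType) (p L : R) (y : nat -> R) (n : nat) :
  1 < p -> (forall i, 0 <= y i) -> 0 <= L ->
  (p - 1) * truncated_max L y n `^ p <=
  \sum_(0 <= i < n) p * ((truncated_max L y i.+1 `^ (p - 1) -
                          truncated_max L y i `^ (p - 1)) * y i).
Proof.
move=> p1 y0 L0; pose N := truncated_max L y; rewrite -/N.
have N0 i : 0 <= N i by exact: truncated_max_ge0.
elim: n => [|n IH].
  by rewrite big_geq// /N/= powR0 ?mulr0//; apply/eqP; lra.
rewrite big_nat_recr//= -lerBlDr; apply: le_trans IH; rewrite lerBlDr.
have : N n.+1 = Num.max (N n) (Num.min (y n) L) by [].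
case: (leP (Num.min (y n) L) (N n)) => [h ->|]; first by lra.
set a := Num.min (y n) L => Na ->.
have ay : a <= y n by rewrite ge_min lexx.
have a0 : 0 < a by exact: le_lt_trans (N0 n) Na.
have Y := @young_powR R p a (N n) p1 (ltW a0) (N0 n).
have pw : N n `^ (p - 1) <= a `^ (p - 1).
  by apply: ge0_ler_powR; rewrite ?nnegrE//; lra.
have E : a * a `^ (p - 1) = a `^ p by apply: mulr_powRB1; lra.
have : p * ((a `^ (p - 1) - N n `^ (p - 1)) * a) <=
       p * ((a `^ (p - 1) - N n `^ (p - 1)) * y n).
  by rewrite ler_pM2l; [rewrite ler_wpM2l// subr_ge0|lra].
have -> : p * ((a `^ (p - 1) - N n `^ (p - 1)) * a) =
          p * a `^ p - p * (a * N n `^ (p - 1)) by rewrite -E; ring.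
lra.
Qed.

(** The increments D i of the p-1st power of the maximum are nonnegative and
    G i-measurable, so integrating them against |Y i| gives at most their
    integral against |X|; summed over i, these telescope. *)
Lemma doob_truncated d (T : measurableType d) (R : realType)
    (P : probability T R) (G : nat -> set_system T) (X : T -> R)
    (Y : nat -> T -> R) (p L : R) (n : nat) :
  1 < p -> 0 <= L ->
  (forall i, is_sub_sigma_algebra (G i)) ->
  (forall i j, (i <= j)%N -> G i `<=` G j) ->
  P.-integrable [set: T] (EFin \o X) ->
  (forall i, is_condexp P (G i) X (Y i)) ->
  (\int[P]_w ((p - 1) * truncated_max L (fun i => `|Y i w|) n `^ p)%:E <=
   \int[P]_w (p * (`|X w| *
      truncated_max L (fun i => `|Y i w|) n `^ (p - 1)))%:E)%E.
Proof.
move=> p1 L0 sG Gmono intX XY.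
pose M i w := truncated_max L (fun i => `|Y i w|) i.
have M0 i w : 0 <= M i w by exact: truncated_max_ge0.
have MS i w : M i.+1 w = Num.max (M i w) (Num.min `|Y i w| L).
  by [].
have mX : measurable_fun [set: T] X.
  exact/measurable_EFinP/(measurable_int P intX).
have mY i : measurable_fun [set: T] (Y i).
  by have [mYi _ _] := XY i; exact: sub_sigma_measurable_fun mYi.
have mYG i j : (i <= j)%N -> measurable_fun [set: g_sigma_algebraType (G j)] (Y i).
  move=> ij; have [mYi _ _] := XY i.
  apply: finer_sigma_measurable_fun mYi; [by case: (sG i)|by case: (sG j)|].
  exact: Gmono.
have mMG i j : (i <= j.+1)%N ->
    measurable_fun [set: g_sigma_algebraType (G j)] (M i).
  elim: i => [_|i IH ij].
    exact: measurable_cst.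
  rewrite (_ : M i.+1 = M i \max ((Num.norm \o Y i) \min cst L)); last first.
    by apply/funext => w; rewrite MS.
  apply: measurable_maxr; first by apply: IH; exact: ltnW.
  apply: measurable_minr => //; apply: measurableT_comp => //; exact: mYG.
pose D i w := p * (M i.+1 w `^ (p - 1) - M i w `^ (p - 1)).
have D0 i w : 0 <= D i w.
  rewrite mulr_ge0//; first by lra.
  rewrite subr_ge0; apply: ge0_ler_powR; rewrite ?nnegrE//; first by lra.
  by rewrite MS le_max lexx.
have mD i : measurable_fun [set: g_sigma_algebraType (G i)] (D i).
  apply: measurable_funM => //; apply: measurable_funB.
    by apply: (measurableT_comp (measurable_powR _)); exact: mMG.
  by apply: (measurableT_comp (measurable_powR _)); exact: mMG.
have mDT i : measurable_fun [set: T] (D i).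
  exact: sub_sigma_measurable_fun (mD i).
have mM i : measurable_fun [set: T] (M i).
  by have := mMG i i (leqnSn i); exact: sub_sigma_measurable_fun.
have mDZ i (Z : T -> R) : measurable_fun [set: T] Z ->
    measurable_fun [set: T] (fun w => (D i w * `|Z w|)%:E).
  move=> mZ; apply/measurable_EFinP; apply: measurable_funM => //.
  exact: measurableT_comp.
apply: (@le_trans _ _ (\int[P]_w \sum_(0 <= i < n) (D i w * `|Y i w|)%:E)%E).
  apply: ge0_le_integral => //.
  - by move=> w _; rewrite lee_fin mulr_ge0 ?powR_ge0//; lra.
  - apply/measurable_EFinP; apply: measurable_funM => //.
    exact: (measurableT_comp (measurable_powR p) (mM n)).
  - by apply: emeasurable_sum => i; exact: mDZ.
  - move=> w _; rewrite sumEFin lee_fin.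
    have := @truncated_max_pathwise R p L (fun i => `|Y i w|) n p1 (fun=> normr_ge0 _) L0.
    move=> /= /le_trans; apply; apply: ler_sum => i _.
    by rewrite /D mulrA.
rewrite ge0_integral_sum//; last 2 first.
  - by move=> i; exact: mDZ.
  - by move=> i w _; rewrite lee_fin mulr_ge0.
apply: (@le_trans _ _ (\int[P]_w \sum_(0 <= i < n) (D i w * `|X w|)%:E)%E); last first.
  rewrite le_eqVlt; apply/orP; left; apply/eqP; apply: eq_integral => w _.
  rewrite sumEFin; congr EFin; rewrite -mulr_suml -mulr_sumr telescope_sumr//.
  rewrite {2}/M/= powR0; last by apply/eqP; lra.
  by rewrite subr0; ring.
rewrite [leRHS]ge0_integral_sum//; last 2 first.
  - by move=> i; exact: mDZ.
  - by move=> i w _; rewrite lee_fin mulr_ge0.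
apply: lee_sum => i _.
apply: (@weighted_integral_le _ _ _ _ (G i)) => //.
- exact: measurableT_comp.
- exact: measurableT_comp.
- by move=> A GA; exact: (@integral_norm_condexp_le _ _ _ _ (G i)).
Qed.

(** * Combining k filtrations *)

Lemma sum_neq_const (R : comPzRingType) (k : nat) (j : 'I_k) (c : R) :
  \sum_(i < k | i != j) c = (k%:R - 1) * c.
Proof.
have : \sum_(i < k) c = c + \sum_(i < k | i != j) c by rewrite (bigD1 j).
rewrite sumr_const card_ord mulrBl mul1r mulr_natl => ->.
by rewrite addrAC subrr add0r.
Qed.

(** All terms but the one of j0 are compared through Young's inequality with
    x itself, the term of j0 through Young's inequality with C x. *)
Lemma max_pathwise (R : realType) (p C x m : R) (k : nat) (f : 'I_k -> R)
    (j0 : 'I_k) :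
  1 < p -> 1 < C -> 0 <= x -> 0 <= m <= f j0 -> (forall j, 0 <= f j) ->
  (p - 1) * (1 - C^-1) * m `^ p + \sum_(j < k) p * (x * f j `^ (p - 1)) <=
  (C `^ (p - 1) + (k%:R - 1)) * x `^ p + \sum_(j < k) (p - 1) * f j `^ p.
Proof.
move=> p1 C1 x0 /andP[m0 mf] f0; have C0 : 0 < C by lra.
have CV : 0 < C^-1 < 1 by rewrite invr_gt0 C0/= invf_lt1.
rewrite (bigD1 j0)//= [X in _ <= _ + X](bigD1 j0)//=.
have rest : \sum_(j < k | j != j0) p * (x * f j `^ (p - 1)) <=
    (k%:R - 1) * x `^ p + \sum_(j < k | j != j0) (p - 1) * f j `^ p.
  apply: (@le_trans _ _
      (\sum_(j < k | j != j0) ((p - 1) * f j `^ p + x `^ p))).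
    by apply: ler_sum => j _; exact: young_powR.
  by rewrite big_split/= addrC lerD2r sum_neq_const.
have mp : m `^ p <= f j0 `^ p by apply: ge0_ler_powR; rewrite ?nnegrE//; lra.
have top : (p - 1) * (1 - C^-1) * m `^ p + p * (x * f j0 `^ (p - 1)) <=
    C `^ (p - 1) * x `^ p + (p - 1) * f j0 `^ p.
  have := @young_powR R p (C * x) (f j0) p1 (mulr_ge0 (ltW C0) x0) (f0 j0).
  rewrite (powRM _ (ltW C0) x0) -(@mulr_powRB1 _ C p)//; [|lra|lra].
  set u := f j0 `^ (p - 1); set v := f j0 `^ p => H.
  have : p * (x * u) <= C^-1 * ((p - 1) * v) + C `^ (p - 1) * x `^ p.
    rewrite -(ler_pM2l C0).
    have -> : C * (C^-1 * ((p - 1) * v) + C `^ (p - 1) * x `^ p) =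
              (p - 1) * v + C * C `^ (p - 1) * x `^ p.
      by field; rewrite gt_eqF.
    by have -> : C * (p * (x * u)) = p * (C * x * u) by ring.
  have : (p - 1) * (1 - C^-1) * m `^ p <= (p - 1) * (1 - C^-1) * v.
    by rewrite ler_wpM2l// mulr_ge0; lra.
  lra.
lra.
Qed.

(** Integrate [max_pathwise]: by Doob's inequality the sum on the right is at most
    the sum on the left, and it is finite because the F j are bounded.  The
    equation for C makes the remaining two coefficients have ratio C^p. *)
Lemma max_integral_le d (T : measurableType d) (R : realType)
    (P : probability T R) (p C L : R) (k : nat) (X m : T -> R)
    (F : 'I_k -> T -> R) :
  1 < p -> 1 < C -> (p - 1) * C `^ p - p * C `^ (p - 1) - (k%:R - 1) = 0 ->
  P.-integrable [set: T] (EFin \o X) ->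
  measurable_fun [set: T] m -> (forall w, 0 <= m w) ->
  (forall w, exists j, m w <= F j w) ->
  (forall j, measurable_fun [set: T] (F j)) ->
  (forall j w, 0 <= F j w <= L) ->
  (forall j, (\int[P]_w ((p - 1) * F j w `^ p)%:E <=
              \int[P]_w (p * (`|X w| * F j w `^ (p - 1)))%:E)%E) ->
  (\int[P]_w (m w `^ p)%:E <= (C `^ p)%:E * \int[P]_w (`|X w| `^ p)%:E)%E.
Proof.
move=> p1 C1 root intX mm m0 mF mF' F0L doobF.
have C0 : 0 < C by lra.
have CV : 0 < C^-1 < 1 by rewrite invr_gt0 C0/= invf_lt1.
have mX : measurable_fun [set: T] X.
  exact/measurable_EFinP/(measurable_int P intX).
have mnX : measurable_fun [set: T] (fun w => `|X w|) by exact: measurableT_comp.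
pose a := (p - 1) * (1 - C^-1); pose b := C `^ (p - 1) + (k%:R - 1).
have a0 : 0 < a by rewrite mulr_gt0; lra.
have bE : b = a * C `^ p.
  move/eqP : root; rewrite subr_eq0 => /eqP; rewrite /b => <-.
  rewrite /a -(@mulr_powRB1 _ C p)//; [|lra|lra].
  by field; rewrite gt_eqF.
have b0 : 0 <= b by rewrite bE mulr_ge0 ?powR_ge0// ltW.
have F0 j w : 0 <= F j w by have /andP[] := F0L j w.
have q0 : 0 <= p - 1 by lra.
have p0 : 0 <= p by lra.
have mp (f : T -> R) r : measurable_fun [set: T] f ->
    measurable_fun [set: T] (fun w => f w `^ r).
  by move=> mf; apply: (measurableT_comp (measurable_powR r)).
pose g j w := (p - 1) * F j w `^ p.
pose h j w := p * (`|X w| * F j w `^ (p - 1)).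
have mg j : measurable_fun [set: T] (EFin \o g j).
  by apply/measurable_EFinP; apply: measurable_funM => //; exact: mp.
have mh j : measurable_fun [set: T] (EFin \o h j).
  apply/measurable_EFinP; apply: measurable_funM => //.
  by apply: measurable_funM => //; exact: mp.
have g0 j w : 0 <= g j w by rewrite mulr_ge0// powR_ge0.
have h0 j w : 0 <= h j w by rewrite !mulr_ge0// powR_ge0.
have mam : measurable_fun [set: T] (fun w => (a * m w `^ p)%:E).
  by apply/measurable_EFinP; apply: measurable_funM => //; exact: mp.
have mbx : measurable_fun [set: T] (fun w => (b * `|X w| `^ p)%:E).
  by apply/measurable_EFinP; apply: measurable_funM => //; exact: mp.
have am0 w : (0 <= (a * m w `^ p)%:E)%E by rewrite lee_fin mulr_ge0 ?powR_ge0// ltW.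
have bx0 w : (0 <= (b * `|X w| `^ p)%:E)%E by rewrite lee_fin mulr_ge0 ?powR_ge0.
have key : (\int[P]_w (a * m w `^ p)%:E + \sum_(j < k) \int[P]_w (h j w)%:E <=
            \int[P]_w (b * `|X w| `^ p)%:E + \sum_(j < k) \int[P]_w (g j w)%:E)%E.
  have sum0 (f : 'I_k -> T -> R) : (forall j w, 0 <= f j w) ->
      forall w, (0 <= \sum_(j < k) (f j w)%:E)%E.
    by move=> f0 w; apply: sume_ge0 => j _; rewrite lee_fin.
  have integral_addsum (u : T -> \bar R) (f : 'I_k -> T -> R) :
      measurable_fun [set: T] u -> (forall w, 0 <= u w)%E ->
      (forall j, measurable_fun [set: T] (EFin \o f j)) ->
      (forall j w, 0 <= f j w) ->
      (\int[P]_w u w + \sum_(j < k) \int[P]_w (f j w)%:E =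
       \int[P]_w (u w + \sum_(j < k) (f j w)%:E))%E.
    move=> mu u0 mf f0; rewrite ge0_integralD//.
    - congr (_ + _)%E; rewrite ge0_integral_sum// => j w _.
      by rewrite lee_fin.
    - by move=> w _; exact: sum0.
    - exact: emeasurable_sum.
  have e1 := integral_addsum _ h mam am0 mh h0.
  have e2 := integral_addsum _ g mbx bx0 mg g0.
  rewrite [X in (X <= _)%E]e1 [X in (_ <= X)%E]e2.
  apply: ge0_le_integral => //.
  - by move=> w _; apply: adde_ge0 => //; exact: sum0.
  - by apply: emeasurable_funD => //; exact: emeasurable_sum.
  - by apply: emeasurable_funD => //; exact: emeasurable_sum.
  - move=> w _; rewrite !sumEFin -!EFinD lee_fin.
    have [j0 mj0] := mF w.
    by apply: (@max_pathwise R p C `|X w| (m w) k (F^~ w) j0); rewrite ?m0.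
have hfin : (\sum_(j < k) \int[P]_w (h j w)%:E)%E \is a fin_num.
  apply/sum_fin_numP => j _ _; rewrite ge0_fin_numE; last first.
    by apply: integral_ge0 => w _; rewrite lee_fin.
  apply: (@le_lt_trans _ _ (\int[P]_w ((p * L `^ (p - 1))%:E * `|X w|%:E))%E).
    apply: ge0_le_integral => //.
    - by move=> w _; rewrite lee_fin.
    - exact: mh.
    - by apply/measurable_EFinP; exact: measurable_funM.
    - move=> w _; rewrite -EFinM lee_fin /h -mulrA ler_wpM2l// mulrC ler_wpM2r//.
      have /andP[_ FL] := F0L j w.
      by apply: ge0_ler_powR; rewrite ?nnegrE// (le_trans _ FL).
  rewrite ge0_integralZl_EFin//; last 2 first.
    exact/measurable_EFinP.
    by rewrite mulr_ge0// powR_ge0.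
  apply: lte_mul_pinfty; rewrite ?lee_fin ?mulr_ge0 ?powR_ge0//.
  by case/integrableP: intX.
(* The two sums cancel. *)
have {}key : (\int[P]_w (a * m w `^ p)%:E <= \int[P]_w (b * `|X w| `^ p)%:E)%E.
  rewrite -(leeD2rE _ _ hfin); apply: le_trans key _.
  by apply: leeD2l; apply: lee_sum => j _; exact: doobF.
have scale (c : R) (f : T -> R) : 0 <= c -> measurable_fun [set: T] f ->
    (\int[P]_w (c * f w `^ p)%:E = c%:E * \int[P]_w (f w `^ p)%:E)%E.
  move=> c0 mf; under eq_integral do rewrite EFinM.
  rewrite ge0_integralZl_EFin//.
    by move=> w _; rewrite lee_fin powR_ge0.
  by apply/measurable_EFinP; exact: mp.
move: key; rewrite (scale a m (ltW a0) mm) (scale b _ b0 mnX).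
by rewrite bE (EFinM a) -muleA lee_pmul2l.
Qed.

Lemma measurable_bigmaxr d (T : measurableType d) (R : realType) (I : Type)
    (s : seq I) (f : I -> T -> R) :
  (forall i, measurable_fun [set: T] (f i)) ->
  measurable_fun [set: T] (fun w => \big[Num.max/0]_(i <- s) f i w).
Proof.
move=> mf; elim: s => [|i s IH].
  by under eq_fun do rewrite big_nil; exact: measurable_cst.
under eq_fun do rewrite big_cons; exact: measurable_maxr.
Qed.

Lemma truncation_integral_le d (T : measurableType d) (R : realType)
    (P : probability T R) (p : R) (M : T -> R) (c : \bar R) :
  0 <= p -> measurable_fun [set: T] M -> (forall w, 0 <= M w) ->
  (forall L : nat, (\int[P]_w (Num.min (M w) L%:R `^ p)%:E <= c)%E) ->
  (\int[P]_w (M w `^ p)%:E <= c)%E.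
Proof.
move=> p0 mM M0 Mc.
pose g (L : nat) w := (Num.min (M w) L%:R `^ p)%:E.
have lim_g w : limn (g^~ w) = (M w `^ p)%:E.
  apply: lim_near_cst => //; near=> L.
  rewrite /g min_l//; near: L; exact: nbhs_infty_ger.
have mg L : measurable_fun [set: T] (g L).
  apply/measurable_EFinP; apply: (measurableT_comp (measurable_powR p)).
  exact: measurable_minr.
have g0 L w : [set: T] w -> (0 <= g L w)%E by rewrite lee_fin powR_ge0.
have ndg w : [set: T] w -> {homo g^~ w : m n / (m <= n)%N >-> (m <= n)%E}.
  move=> _ m n mn; rewrite lee_fin; apply: ge0_ler_powR => //.
  - by rewrite nnegrE le_min M0 ler0n.
  - by rewrite nnegrE le_min M0 ler0n.
  - by rewrite le_min !ge_min lexx/= ler_nat mn orbT.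
have cvg_int := cvg_monotone_convergence (mu := P) measurableT mg g0 ndg.
have -> : (\int[P]_w (M w `^ p)%:E = \int[P]_w limn (g^~ w))%E.
  by apply: eq_integral => w _; rewrite lim_g.
rewrite -(cvg_lim _ cvg_int)//; apply: lime_le; last exact: nearW.
by apply/cvg_ex; eexists; exact: cvg_int.
Unshelve. all: by end_near. Qed.

Lemma Lnorm_le_of_powR_integral_le d (T : measurableType d) (R : realType)
    (P : probability T R) (p C : R) (f g : T -> R) :
  0 < p -> 0 <= C ->
  (\int[P]_w (`|f w| `^ p)%:E <= (C `^ p)%:E * \int[P]_w (`|g w| `^ p)%:E)%E ->
  ('N[P]_p%:E[EFin \o f] <= C%:E * 'N[P]_p%:E[EFin \o g])%E.
Proof.
move=> p0 C0 fg; rewrite unlock /Lnorm/=.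
have -> : C%:E = ((C `^ p)%:E `^ p^-1)%E.
  by rewrite poweR_EFin -powRrM divff ?gt_eqF// powRr1.
have I0 (h : T -> R) : (0 <= \int[P]_w (`|h w| `^ p)%:E)%E.
  by apply: integral_ge0 => w _; rewrite lee_fin powR_ge0.
rewrite -poweRM//; last by rewrite lee_fin powR_ge0.
apply: gt0_ler_poweR => //; rewrite ?in_itv/= ?leey ?andbT.
- by rewrite invr_ge0 ltW.
- exact: I0.
- by apply: mule_ge0 => //; rewrite lee_fin powR_ge0.
Qed.

Lemma measurable_maximal_function d (T : measurableType d) (R : realType)
    (P : probability T R) (n k : nat) (G : 'I_n -> 'I_k -> set_system T)
    (xi : T -> R) :
  filtration_family G -> P.-integrable [set: T] (EFin \o xi) ->
  measurable_fun [set: T] (maximal_function P G xi).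
Proof.
move=> [sG _] intX; apply: measurable_bigmaxr => i.
apply: measurable_bigmaxr => j; apply: measurableT_comp => //.
have [mY _ _] := condexpP (sG i j) intX.
exact: sub_sigma_measurable_fun mY.
Qed.

Lemma maximal_function_ge0 d (T : measurableType d) (R : realType)
    (P : probability T R) (n k : nat) (G : 'I_n -> 'I_k -> set_system T)
    (xi : T -> R) (w : T) : 0 <= maximal_function P G xi w.
Proof. exact: bigmax_ge_id. Qed.

Lemma Lfun_integrable_gt1 d (T : measurableType d) (R : realType)
    (P : probability T R) (p : R) (xi : T -> R) :
  1 < p -> xi \in Lfun P p%:E -> P.-integrable [set: T] (EFin \o xi).
Proof.
move=> p1 xiLp; apply/Lfun1_integrable.
have p1' : (1 <= p%:E)%E by rewrite lee_fin ltW.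
have Pfin : P [set: T] \is a fin_num by exact: fin_num_measure.
exact: (@Lfun_subset _ _ _ P 1%E p%:E (lexx _) p1' Pfin p1' _ xiLp).
Qed.

(** [max_integral_le] is applied to the maximal function truncated at L, which lies
    below the largest of the k truncated running maxima. *)
Lemma maximal_Lnorm_le d (T : measurableType d) (R : realType)
    (P : probability T R) (p C : R) (n k : nat)
    (G : 'I_n -> 'I_k -> set_system T) (xi : T -> R) :
  1 < p -> 1 < C -> (p - 1) * C `^ p - p * C `^ (p - 1) - (k%:R - 1) = 0 ->
  (1 <= k)%N -> (1 <= n)%N -> filtration_family G -> xi \in Lfun P p%:E ->
  ('N[P]_p%:E[EFin \o maximal_function P G xi] <= C%:E * 'N[P]_p%:E[EFin \o xi])%E.
Proof.
move=> p1 C1 root k1 n1 fG xiLp; have [sG Gmono] := fG.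
case: n n1 G fG sG Gmono => // n _ G fG sG Gmono.
have intX := @Lfun_integrable_gt1 _ _ _ _ _ _ p1 xiLp.
set M := maximal_function P G xi.
have mM : measurable_fun [set: T] M by exact: measurable_maximal_function.
have M0 w : 0 <= M w by exact: maximal_function_ge0.
apply: Lnorm_le_of_powR_integral_le; [lra|lra|].
under eq_integral do rewrite ger0_norm//.
apply: truncation_integral_le => //; first by lra.
move=> L.
(* Doob's inequality is about sequences: the j-th filtration is extended
   beyond its last term by repeating that term. *)
pose G' j i := G (inord (minn i n)) j.
pose Y j i := condexp P (G' j i) xi.
pose F (j : 'I_k) w := truncated_max L%:R (fun i => `|Y j i w|) n.+1.
have YP j i : is_condexp P (G' j i) xi (Y j i) by exact: (condexpP (sG _ _)).
have mY j i : measurable_fun [set: T] (Y j i).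
  have [mYij _ _] := YP j i.
  exact: (@sub_sigma_measurable_fun _ _ _ _ _ _ (sG _ j) mYij).
have mF (j : 'I_k) : measurable_fun [set: T] (F j).
  rewrite /F; elim: n.+1 => [|m IH] /=; first exact: measurable_cst.
  apply: measurable_maxr => //; apply: measurable_minr => //.
  exact: measurableT_comp.
apply: (@max_integral_le _ _ _ _ _ _ L%:R k _ _ F) => //.
- exact: measurable_minr.
- by move=> w; rewrite le_min M0 ler0n.
- move=> w; pose j0 : 'I_k := Ordinal k1.
  have [j _ jmax] := arg_maxP (fun j => F j w) (isT : xpredT j0).
  exists j; rewrite ge_min; case: (leP L%:R (F j w)) => [|FL]; rewrite ?orbT// orbF.
  apply/bigmax_leP; split=> [|i _]; first exact: truncated_max_ge0.
  apply/bigmax_leP; split=> [|j' _]; first exact: truncated_max_ge0.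
  have := @le_truncated_max R L%:R (fun i => `|Y j' i w|) n.+1 i (ltn_ord i).
  move=> /le_trans/(_ (jmax j' isT)); rewrite ge_min [X in _ || X]leNgt FL orbF.
  by rewrite /Y /G' (minn_idPl _) ?inord_val// -ltnS.
- by move=> j w; rewrite truncated_max_ge0 truncated_max_le.
- move=> j; apply: doob_truncated => //.
  + by move=> i; exact: sG.
  + move=> i i' ii'; apply: Gmono; rewrite !inordK ?ltnS ?geq_minr//.
    by rewrite leq_min geq_minr andbT geq_min ii'.
Qed.

(** * Intermediate values of a nonatomic probability *)

Section nonatomic.
Context d (T : measurableType d) (R : realType) (P : probability T R).
Implicit Types A B U V : set T.

Local Notation pr A := (fine (P A)).

Let prE A : measurable A -> P A = (pr A)%:E.
Proof. by move=> mA; rewrite fineK//; exact: fin_num_measure. Qed.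

Let pr_ge0 A : 0 <= pr A. Proof. exact: fine_ge0. Qed.

Let pr_le1 A : measurable A -> pr A <= 1.
Proof. by move=> mA; rewrite -lee_fin -prE// probability_le1. Qed.

Let pr_le A B : measurable A -> measurable B -> A `<=` B -> pr A <= pr B.
Proof.
by move=> mA mB AB; rewrite -lee_fin -!prE//; apply: le_measure; rewrite ?inE.
Qed.

Let prD A B : measurable A -> measurable B -> B `<=` A ->
  pr (A `\` B) = pr A - pr B.
Proof.
move=> mA mB BA; have mAB : measurable (A `\` B) by exact: measurableD.
have : P A = (P B + P (A `\` B))%E.
  rewrite -measureU//; first by rewrite setDUK.
  by rewrite setDIK.
by rewrite (prE mA) (prE mB) (prE mAB) -EFinD => -[->]; rewrite addrAC subrr add0r.
Qed.

(** Of two complementary parts of positive mass, one has at most half the mass: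
    iterate. *)
Lemma nonatomic_small_subset (hP : nonatomic P) A (e : R) :
  measurable A -> 0 < pr A -> 0 < e ->
  exists B, [/\ measurable B, B `<=` A, 0 < pr B & pr B <= e].
Proof.
move=> mA A0 e0.
have half (n : nat) :
    exists B, [/\ measurable B, B `<=` A, 0 < pr B & pr B <= 2^-1 ^+ n].
  elim: n => [|n [B [mB BA B0 Bn]]].
    by exists A; split => //; rewrite expr0 pr_le1.
  have [|C [mC CB]] := hP B mB; first by rewrite prE// lte_fin.
  rewrite (prE mB) (prE mC) !lte_fin => C0 CltB.
  have BC0 := prD mB mC CB.
  have [h|h] := leP (pr C) (pr B / 2).
    exists C; split => //; first exact: subset_trans BA.
    by rewrite exprS; lra.
  exists (B `\` C); split; [exact: measurableD|by move=> w [/BA]| |].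
    by rewrite BC0 subr_gt0.
  by rewrite BC0 exprS; lra.
have [N Ne] : exists N, 2^-1 ^+ N < e.
  have h2 : `|2^-1 : R| < 1 by rewrite ger0_norm; lra.
  have [N _ HN] := cvgr_lt _ (cvg_expr h2) _ e0.
  by exists N; exact: HN (leqnn N).
have [B [mB BA B0 BN]] := half N; exists B; split => //.
exact: le_trans BN (ltW Ne).
Qed.

(** One step of an exhaustion: U' gains at least half of what any admissible
    extension V of U could gain.  The hypotheses on U are placed under the
    existential so that the lemma yields a choice function on all sets. *)
Lemma greedy_extension A (c : R) U :
  exists U', measurable U -> U `<=` A -> pr U <= c ->
    [/\ measurable U', U `<=` U', U' `<=` A, pr U' <= c &
      forall V, measurable V -> U `<=` V -> V `<=` A -> pr V <= c ->
        pr V - pr U <= 2 * (pr U' - pr U)].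
Proof.
have [[mU UA Uc]|noU] := pselect [/\ measurable U, U `<=` A & pr U <= c]; last first.
  by exists U => mU UA Uc; exfalso; apply: noU.
pose E := [set pr V | V in
  [set V | [/\ measurable V, U `<=` V, V `<=` A & pr V <= c]]].
have EU : E (pr U) by exists U => //; split.
have supE : has_sup E.
  split; first by exists (pr U).
  by exists 1 => _ [V [mV _ _ _] <-]; exact: pr_le1.
have Ele V : measurable V -> U `<=` V -> V `<=` A -> pr V <= c -> pr V <= sup E.
  by move=> mV UV VA Vc; apply: ub_le_sup; [case: supE|exists V => //; split].
have [supU|Usup] := leP (sup E) (pr U).
  exists U => _ _ _; split => // V mV UV VA Vc.
  by have := Ele V mV UV VA Vc; lra.
have e0 : 0 < (sup E - pr U) / 2 by lra.
have [_ [U' [mU' UU' U'A U'c] <-] U'sup] := sup_adherent e0 supE.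
exists U' => _ _ _; split => // V mV UV VA Vc.
by have := Ele V mV UV VA Vc; lra.
Qed.

(** Sierpinski's theorem.  If the union W of a greedy exhaustion had mass less
    than c, a small set B of positive mass could be added to it; since B could
    have been added at every step, every step gained at least half of the mass
    of B, which is impossible. *)
Lemma nonatomic_intermediate (hP : nonatomic P) A (c : R) :
  measurable A -> 0 <= c -> (c%:E <= P A)%E ->
  exists B, [/\ measurable B, B `<=` A & P B = c%:E].
Proof.
move=> mA c0 cA; have {}cA : c <= pr A by rewrite -lee_fin -prE.
have [f fP] := choice (greedy_extension A c).
pose U n := iter n f set0.
have UP n : [/\ measurable (U n), U n `<=` A & pr (U n) <= c].
  elim: n => [|n [mU UA Uc]]; first by split => //=; rewrite ?measure0//; exact: sub0set.
  by have [mU' _ U'A U'c _] := fP (U n) mU UA Uc.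
have mU n : measurable (U n) by have [] := UP n.
have UA n : U n `<=` A by have [] := UP n.
have Uc n : pr (U n) <= c by have [] := UP n.
have US n : U n `<=` U n.+1 by have [] := fP (U n) (mU n) (UA n) (Uc n).
have ndU : nondecreasing_seq U.
  by apply/nondecreasing_seqP => n; exact/subsetPset.
pose W := \bigcup_n U n.
have mW : measurable W by exact: bigcup_measurable.
have WA : W `<=` A by move=> w [n _ /UA].
have Wc : pr W <= c.
  rewrite -lee_fin -prE//.
  have cvgU := nondecreasing_cvg_mu (mu := P) mU mW ndU.
  rewrite -(cvg_lim _ cvgU)//; apply: lime_le.
    by apply/cvg_ex; eexists; exact: cvgU.
  by apply: nearW => n /=; rewrite prE// lee_fin.
exists W; split => //; rewrite prE//; congr EFin; apply/eqP.
rewrite eq_le Wc/= leNgt; apply/negP => Wltc.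
have [|||B [mB BAW B0 Bc]] := nonatomic_small_subset hP (A := A `\` W) (e := c - pr W).
- exact: measurableD.
- by rewrite prD//; lra.
- by lra.
have prV : pr (W `|` B) = pr W + pr B.
  have WB0 : W `&` B = set0 by apply/seteqP; split=> w // [Ww /BAW[_]].
  by rewrite measureU// fineD//; exact: fin_num_measure.
have incr n : pr B <= 2 * (pr (U n.+1) - pr (U n)).
  have [_ _ _ _ H] := fP (U n) (mU n) (UA n) (Uc n).
  have UW : U n `<=` W by move=> w Uw; exists n.
  have mV : measurable (W `|` B) by exact: measurableU.
  have UV : U n `<=` W `|` B by move=> w /UW; left.
  have VA : W `|` B `<=` A by move=> w [/WA|/BAW[]].
  have Vc : pr (W `|` B) <= c by rewrite prV; lra.
  have := H _ mV UV VA Vc; rewrite prV.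
  have := pr_le (mU n) mW UW; rewrite /U/=; lra.
have lin n : n%:R * pr B <= 2 * pr (U n).
  elim: n => [|n IH]; first by rewrite mul0r mulr_ge0.
  by rewrite -natr1 mulrDl mul1r; have := incr n; lra.
have [n nB] : exists n : nat, 2 / pr B < n%:R.
  by exists (Num.bound (2 / pr B)); apply: archi_boundP; rewrite divr_ge0 ?ltW.
have := lin n; have := pr_le1 (mU n); move: nB; rewrite ltr_pdivrMr//; lra.
Qed.

Lemma nonatomic_disjoint_family (hP : nonatomic P) (w : nat -> R) (n : nat) A :
  measurable A -> (forall i, 0 <= w i) ->
  ((\sum_(i < n) w i)%:E <= P A)%E ->
  exists B : nat -> set T,
    [/\ forall i, measurable (B i), forall i, B i `<=` A,
        trivIset [set: nat] B & forall i, (i < n)%N -> P (B i) = (w i)%:E].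
Proof.
move=> + w0; elim: n A => [|n IH] A mA.
  by move=> _; exists (fun=> set0); split => // [i|];
    [exact: sub0set|move=> i j _ _ [x []]].
rewrite big_ord_recr/= => wA.
have S0 : 0 <= \sum_(i < n) w i by exact: sumr_ge0.
have [|B0 [mB0 B0A PB0]] := nonatomic_intermediate hP mA (w0 n).
  by apply: le_trans wA; rewrite lee_fin lerDr.
have mAB : measurable (A `\` B0) by exact: measurableD.
have [|B [mB BA tB PB]] := IH _ mAB.
  rewrite prE// lee_fin prD//; move: wA; rewrite (prE mA) lee_fin.
  have : pr B0 = w n by rewrite PB0.
  lra.
exists (fun i => if i == n then B0 else if (i < n)%N then B i else set0); split.
- by move=> i; case: ifP => // _; case: ifP.
- by move=> i; case: ifP => // _; case: ifP => // _ x; [case/BA|].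
- have BB0 l x : B l x -> B0 x -> False by move=> /BA[].
  move=> i j _ _ [x []]; case: eqP => [->|_]; case: eqP => [->|_] //.
  + by move=> B0x; case: ifP => // _ /BB0 /(_ B0x).
  + by case: ifP => // _ /BB0 h /h.
  + case: ifP => // _; case: ifP => // _ Bi Bj.
    by apply: tB => //; exists x.
- move=> i; rewrite ltnS leq_eqVlt; case: eqP => [->//|_ /= iN].
  by rewrite iN PB.
Qed.

End nonatomic.

(** * Step functions and sigma-algebras with an atom *)

Lemma nonatomic_disjoint_finfamily d (T : measurableType d) (R : realType)
    (P : probability T R) (hP : nonatomic P) (I : finType) (w : I -> R) :
  (forall i, 0 <= w i) -> \sum_i w i <= 1 ->
  exists B : I -> set T,
    [/\ forall i, measurable (B i), trivIset [set: I] B &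
        forall i, P (B i) = (w i)%:E].
Proof.
move=> w0 w1.
pose w' n := if insub n is Some i then w (enum_val (i : 'I_#|I|)) else 0.
have w'E (i : 'I_#|I|) : w' i = w (enum_val i) by rewrite /w' valK.
have w'0 n : 0 <= w' n by rewrite /w'; case: insub.
have sw : (((\sum_(i < #|I|) w' i)%:E <= P [set: T])%E).
  rewrite probability_setT lee_fin (eq_bigr _ (fun i _ => w'E i)).
  by rewrite -(big_enum_val (A := I) w).
have [B [mB _ tB PB]] := nonatomic_disjoint_family hP measurableT w'0 sw.
exists (fun i => B (enum_rank i)); split => // [i j _ _ h|i].
  by apply: enum_rank_inj; apply: val_inj; exact: tB.
by rewrite PB// w'E enum_rankK.
Qed.

Section step_functions.
Context d (T : measurableType d) (R : realType) (P : probability T R).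
Variables (I : finType) (B : I -> set T).
Hypothesis mB : forall i, measurable (B i).
Hypothesis tB : trivIset [set: I] B.

Definition step_fun (v : I -> R) (x : T) : R := \sum_i v i * \1_(B i) x.

Lemma step_funE (v : I -> R) i x : B i x -> step_fun v x = v i.
Proof.
move=> Bix; rewrite /step_fun (bigD1 i)//= indicE mem_set// mulr1.
rewrite big1 ?addr0// => j ji; rewrite indicE memNset ?mulr0// => Bjx.
by move/eqP: ji; apply; apply: tB => //; exists x.
Qed.

Lemma step_fun_out (v : I -> R) x : (forall i, ~ B i x) -> step_fun v x = 0.
Proof.
by move=> nB; apply: big1 => i _; rewrite indicE memNset ?mulr0//; exact: nB.
Qed.

Lemma step_fun_ge0 (v : I -> R) x : (forall i, 0 <= v i) -> 0 <= step_fun v x.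
Proof. by move=> v0; apply: sumr_ge0 => i _; rewrite mulr_ge0. Qed.

(** At most one term of the sum is nonzero at each point, and none outside the
    cells, whence the condition on f. *)
Lemma step_fun_comp (f : R -> R) (v : I -> R) x :
  f 0 = 0 -> f (step_fun v x) = step_fun (f \o v) x.
Proof.
move=> f0; have [[i Bix]|nB] := pselect (exists i, B i x).
  by rewrite !(step_funE _ Bix).
by rewrite !step_fun_out// => i Bix; apply: nB; exists i.
Qed.

Lemma measurable_step_fun (v : I -> R) : measurable_fun [set: T] (step_fun v).
Proof.
apply: measurable_sum => i; apply: measurable_funM => //.
Qed.

Lemma integral_step_fun (v : I -> R) (D : set T) :
  measurable D -> (forall i, 0 <= v i) ->
  (\int[P]_(x in D) (step_fun v x)%:E = \sum_i (v i)%:E * P (B i `&` D))%E.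
Proof.
move=> mD v0; under eq_integral do rewrite /step_fun -sumEFin.
rewrite ge0_integral_sum//.
- apply: eq_bigr => i _; under eq_integral do rewrite EFinM.
  rewrite ge0_integralZl_EFin//.
  + by rewrite integral_indic.
  + by apply/measurable_EFinP; exact: measurable_indic.
- move=> i; apply/measurable_EFinP; apply: measurable_funM => //.
- by move=> i x _; rewrite lee_fin mulr_ge0.
Qed.

Definition cells (S : pred I) : set T := [set x | exists2 i, S i & B i x].

Lemma measurable_cells (S : pred I) : measurable (cells S).
Proof.
rewrite (_ : cells S = \bigcup_(i in [set i | S i]) B i).
  by apply: fin_bigcup_measurable => //; exact: finite_finset.
by apply/seteqP; split=> x [i Si Bi]; exists i.
Qed.

Lemma integral_step_fun_cells (v : I -> R) (S : pred I) :
  (forall i, 0 <= v i) ->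
  (\int[P]_(x in cells S) (step_fun v x)%:E = \sum_(i | S i) (v i)%:E * P (B i))%E.
Proof.
move=> v0; rewrite integral_step_fun//; last exact: measurable_cells.
rewrite [RHS]big_mkcond; apply: eq_bigr => i _; case: ifPn => Si.
  congr (_ * P _)%E; apply/seteqP; split=> x; first by case.
  by move=> Bx; split => //; exists i.
rewrite (_ : _ `&` _ = set0) ?measure0 ?mule0//.
apply/seteqP; split => // x [Bix [j Sj Bjx]].
have ij : i = j by apply: tB => //; exists x.
by move: Si; rewrite ij Sj.
Qed.

Lemma measure_cells (S : pred I) : P (cells S) = (\sum_(i | S i) P (B i))%E.
Proof.
have <- : (\int[P]_(x in cells S) (step_fun (fun=> 1) x)%:E = P (cells S))%E.
  rewrite -[RHS]mul1e -integral_cst; last exact: measurable_cells.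
  by apply: eq_integral => x /set_mem[i _ Bix]; rewrite (step_funE _ Bix).
rewrite integral_step_fun_cells//.
by apply: eq_bigr => i _; rewrite mul1e.
Qed.

End step_functions.

Section atom.
Context d (T : measurableType d).

(** The largest sub-sigma-algebra having A as an atom.  It grows when A shrinks, so
    a decreasing sequence of sets gives a filtration. *)
Definition atom_sigma (A : set T) : set_system T :=
  [set X | measurable X /\ (A `<=` X \/ A `&` X = set0)].

Lemma atom_sigma_sub_sigma (A : set T) : is_sub_sigma_algebra (atom_sigma A).
Proof.
split; last by move=> X [].
split.
- by split => //; right; rewrite setI0.
- move=> X [mX AX]; split; first exact: measurableD.
  case: AX => AX; [right|left].
    by apply/seteqP; split => // x [/AX Xx [_]].
  move=> x Ax; split => // Xx.
  by have : (A `&` X) x by []; rewrite AX.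
- move=> X GX; split.
    by apply: bigcup_measurable => n _; have [] := GX n.
  have [[n AX]|noA] := pselect (exists n, A `<=` X n).
    by left => x /AX Xx; exists n.
  right; apply/seteqP; split => // x [Ax [n _ Xx]].
  have [_ [AX|AX]] := GX n; first by apply: noA; exists n.
  by have : (A `&` X n) x by []; rewrite AX.
Qed.

Lemma atom_sigma_anti (A A' : set T) :
  A' `<=` A -> atom_sigma A `<=` atom_sigma A'.
Proof.
move=> A'A X [mX [AX|AX]]; split => //; first by left; exact: subset_trans AX.
by right; apply/seteqP; split => // x [/A'A Ax Xx]; rewrite -AX.
Qed.

(** The level set of Y through x belongs to the sigma-algebra and meets A, hence
    contains A: Y is constant on the atom, and this constant is the mean of X. *)
Lemma condexp_on_atom (R : realType) (P : probability T R) (A : set T)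
    (X Y : T -> R) (x : T) :
  measurable A -> is_condexp P (atom_sigma A) X Y -> A x ->
  ((Y x)%:E * P A = \int[P]_(w in A) (X w)%:E)%E.
Proof.
move=> mA [mY _ YX] Ax; have [sG _] := atom_sigma_sub_sigma A.
have : atom_sigma A (Y @^-1` [set Y x]).
  rewrite -measurable_g_sigmaE// -[_ @^-1` _]setTI.
  exact: mY.
case=> _ [AY|AY]; last first.
  by have : (A `&` Y @^-1` [set Y x]) x by []; rewrite AY.
rewrite -YX; last by split => //; left.
rewrite -integral_cst//; apply: eq_integral => w /set_mem/AY/= ->.
by [].
Qed.

End atom.

(** * Geometric levels *)

Lemma powR_exprn (R : realType) (x r : R) (l : nat) :
  0 <= x -> (x `^ r) ^+ l = (x ^+ l) `^ r.
Proof. by move=> x0; rewrite -powR_mulrn ?powR_ge0// powRAC powR_mulrn. Qed.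

Lemma telescoping_tail (R : realType) (c r : R) (N i : nat) : (i <= N)%N ->
  \sum_(m < N.+1 | (i <= m)%N)
     (if (m < N)%N then c * (r ^+ m - r ^+ m.+1) else c * r ^+ N) = c * r ^+ i.
Proof.
move=> iN; rewrite -(big_geq_mkord i N.+1 predT
  (fun m => if (m < N)%N then c * (r ^+ m - r ^+ m.+1) else c * r ^+ N)).
rewrite big_nat_recr//= ltnn.
rewrite (eq_big_nat _ _ (F2 := fun m => - (c * r ^+ m.+1 - c * r ^+ m))); last first.
  by move=> m /andP[_ ->]; ring.
by rewrite sumrN telescope_sumr// opprB subrK.
Qed.

Lemma sum_column_rows (R : realType) (k N : nat) (j : 'I_k) (i i' : nat)
    (F : nat -> R) :
  \sum_(x : 'I_k * 'I_N.+1 | ((if x.1 == j then i else i') <= x.2)%N) F x.2 =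
  \sum_(m < N.+1 | (i <= m)%N) F m +
  (k%:R - 1) * \sum_(m < N.+1 | (i' <= m)%N) F m.
Proof.
rewrite -(pair_big_dep xpredT (fun j' (m : 'I_N.+1) =>
  ((if j' == j then i else i') <= m)%N) (fun _ (m : 'I_N.+1) => F m))/=.
rewrite (bigD1 j)//= eqxx; congr (_ + _).
rewrite (eq_bigr (fun=> \sum_(m < N.+1 | (i' <= m)%N) F m)); last first.
  by move=> j' /negbTE ->.
exact: sum_neq_const.
Qed.

Section geometric_levels.
Context (R : realType) (p C q : R) (k s n : nat).
Hypotheses (p1 : 1 < p) (C1 : 1 < C) (k1 : (1 <= k)%N) (q1 : 1 < q).
Hypothesis root : (p - 1) * C `^ p - p * C `^ (p - 1) - (k%:R - 1) = 0.
Hypothesis qsC : q ^+ s = C.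

Let N := (s + n)%N.
Let a := q^-1 `^ p.
Let b := q^-1 `^ (p - 1).
(** The mean of the untruncated geometric profile over the levels m >= N is this
    multiple of q^N.  Giving that value to the top level keeps all tail means
    unaffected by the truncation. *)
Definition top_factor := (1 - a) / (1 - b).

Let y01 : 0 < q^-1 < 1.
Proof.
move: (p1) (q1) => p1' q1'.
have q0 : 0 < q by lra. by rewrite invr_gt0 q0 invf_lt1. Qed.

Let abE : a = q^-1 * b.
Proof.
move: (p1) (q1) => p1' q1'.
by rewrite /a /b mulr_powRB1//; have := y01; lra. Qed.

Let a01 : 0 < a < 1.
Proof.
move: (p1) (q1) => p1' q1'.
have y := y01; rewrite powR_gt0/=; last by lra.
have : q^-1 `^ p < 1 `^ p by apply: gt0_ltr_powR; rewrite ?nnegrE; lra.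
by rewrite powR1.
Qed.

Let b01 : 0 < b < 1.
Proof.
move: (p1) (q1) => p1' q1'.
have y := y01; rewrite powR_gt0/=; last by lra.
have : q^-1 `^ (p - 1) < 1 `^ (p - 1) by apply: gt0_ltr_powR; rewrite ?nnegrE; lra.
by rewrite powR1.
Qed.

Lemma top_factor_gt0 : 0 < top_factor.
Proof.
move: (p1) (q1) => p1' q1'.
by rewrite divr_gt0//; have := a01; have := b01; lra. Qed.

(** Young's inequality for 1/q and 1: the factor is at least p / (p-1), its limit
    as q tends to 1, divided by q. *)
Lemma top_factor_ge : p <= top_factor * q * (p - 1).
Proof.
move: (p1) (q1) => p1' q1'.
have y := y01; have b1 := b01.
have Y := @young_powR R p q^-1 1 p1 ltac:(lra) ler01.
rewrite !powR1 -/a in Y.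
have q0 : 0 < q by lra.
have -> : top_factor * q * (p - 1) = (1 - a) * (p - 1) * q / (1 - b).
  by rewrite /top_factor; field; lra.
rewrite ler_pdivlMr; last by lra.
rewrite -(ler_pM2l (proj1 (andP y))).
have -> : q^-1 * ((1 - a) * (p - 1) * q) = (1 - a) * (p - 1).
  by field; lra.
have : q^-1 * (p * (1 - b)) = p * q^-1 - p * a by rewrite abE; ring.
lra.
Qed.

Let qaE l : q ^+ l * a ^+ l = b ^+ l.
Proof.
move: (q1) => q1'; have q0 : q != 0 by rewrite gt_eqF//; lra.
by rewrite abE exprMn exprVn mulrA divff ?expf_neq0// mul1r.
Qed.

(** This and [shifted_value] are the equation for C, written for the quantities C^(-p) and
    C^(1-p) which shift a tail by s levels. *)
Let shifted_mass : (k%:R - 1) * a ^+ s = (p - 1) - p / C.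
Proof.
move: (p1) (C1) (q1) => p1' C1' q1'.
have C0 : 0 < C by lra.
have -> : a ^+ s = (C `^ p)^-1.
  rewrite /a powR_exprn; last by have := y01; lra.
  by rewrite exprVn qsC -powR_inv1 ?ltW// -powRrM mulN1r powRN.
have Cp0 : 0 < C `^ p by exact: powR_gt0.
have E : C * C `^ (p - 1) = C `^ p by rewrite mulr_powRB1//; lra.
have -> : k%:R - 1 = (p - 1) * C `^ p - p * C `^ (p - 1).
  by move: root; lra.
have -> : C `^ (p - 1) = C `^ p / C by rewrite -E; field; lra.
by field; rewrite !gt_eqF.
Qed.

Let shifted_value : (k%:R - 1) * b ^+ s = (p - 1) * C - p.
Proof.
move: (p1) (C1) (q1) => p1' C1' q1'.
have q0 : 0 < q by lra.
rewrite -qaE qsC mulrCA shifted_mass.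
have C0 : C != 0 by rewrite gt_eqF//; lra.
by field.
Qed.

(** Masses decay like q^(-pm), with the whole remaining tail on level N, and are
    shared equally by the k columns. *)
Definition level_mass (m : nat) : R :=
  if (m < N)%N then k%:R^-1 * (a ^+ m - a ^+ m.+1) else k%:R^-1 * a ^+ N.

Definition level_value (m : nat) : R :=
  if (m < N)%N then q ^+ m else top_factor * q ^+ N.

Let k0 : 0 < k%:R :> R. Proof. by rewrite ltr0n. Qed.

Lemma level_mass_ge0 m : 0 <= level_mass m.
Proof.
move: (p1) (q1) => p1' q1'.
have a1 := a01; rewrite /level_mass; case: ifP => _.
  rewrite mulr_ge0 ?invr_ge0 ?ler0n// subr_ge0 exprS ler_piMl ?exprn_ge0//; lra.
by rewrite mulr_ge0 ?invr_ge0 ?ler0n// exprn_ge0//; lra.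
Qed.

Lemma level_value_ge0 m : 0 <= level_value m.
Proof.
move: (p1) (q1) => p1' q1'.
have t0 := top_factor_gt0; rewrite /level_value; case: ifP => _.
  by rewrite exprn_ge0//; lra.
by rewrite mulr_ge0 ?exprn_ge0//; lra.
Qed.

Lemma sum_level_mass : \sum_(x : 'I_k * 'I_N.+1) level_mass x.2 = 1.
Proof.
rewrite -(pair_big_dep xpredT (fun _ (m : 'I_N.+1) => true)
   (fun _ (m : 'I_N.+1) => level_mass m))/=.
rewrite sumr_const card_ord (telescoping_tail _ _ (leq0n N)).
by rewrite expr0 mulr1 -[LHS]mulr_natr mulVf// gt_eqF.
Qed.

(** The contributions to the mean of xi also telescope, with ratio q^(1-p). *)
Lemma level_mass_value m : level_value m * level_mass m =
  if (m < N)%N then (top_factor / k%:R) * (b ^+ m - b ^+ m.+1)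
  else (top_factor / k%:R) * b ^+ N.
Proof.
move: (p1) (q1) => p1' q1'.
have b1 := b01.
rewrite /level_value /level_mass; case: ifP => _; last by rewrite -qaE; ring.
rewrite !exprS -qaE /top_factor; field.
by rewrite !gt_eqF//; lra.
Qed.

Section atom_sums.
Variables (j : 'I_k) (i : nat).
Hypothesis ilt : (i < n)%N.

(* The i-th atom of the j-th filtration: column j from level i on, and the other
   columns from level i + s on, where the values are C times larger. *)
Let S (x : 'I_k * 'I_N.+1) := ((if x.1 == j then i else i + s) <= x.2)%N.

Let iN : (i <= N)%N. Proof. exact: leq_trans (ltnW ilt) (leq_addl _ _). Qed.
Let isN : (i + s <= N)%N. Proof. by rewrite addnC leq_add2l ltnW. Qed.

Lemma atom_mass : \sum_(x | S x) level_mass x.2 = k%:R^-1 * a ^+ i * (p - p / C).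
Proof.
rewrite /S sum_column_rows !telescoping_tail//.
rewrite exprD; have := shifted_mass; set u := a ^+ s; set v := a ^+ i => E.
have -> : k%:R^-1 * v + (k%:R - 1) * (k%:R^-1 * (v * u)) =
  k%:R^-1 * v * (1 + (k%:R - 1) * u) by ring.
by rewrite E; congr (_ * _); ring.
Qed.

Lemma atom_mass_gt0 : 0 < \sum_(x | S x) level_mass x.2.
Proof.
move: (p1) (C1) => p1' C1'; have C0 : 0 < C by lra.
rewrite atom_mass -{1}[p]mulr1 -mulrBr !mulr_gt0 ?invr_gt0 ?exprn_gt0//.
- by have := a01; lra.
- by lra.
- by rewrite subr_gt0 invf_lt1.
Qed.

(** Mass and integral over the atom are tails of two geometric sequences, and the
    equation for C turns their ratio into top_factor (p-1)/p C q^i. *)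
Lemma atom_mean_ge :
  C / q * q ^+ i * (\sum_(x | S x) level_mass x.2) <=
  \sum_(x | S x) level_value x.2 * level_mass x.2.
Proof.
move: (p1) (C1) (q1) => p1' C1' q1'.
have q0 : 0 < q by lra.
have C0 : 0 < C by lra.
rewrite atom_mass.
pose F m := if (m < N)%N then (top_factor / k%:R) * (b ^+ m - b ^+ m.+1)
  else (top_factor / k%:R) * b ^+ N.
rewrite (eq_bigr (fun x : 'I_k * 'I_N.+1 => F x.2)); last by move=> x _; exact: level_mass_value.
rewrite (sum_column_rows N j i (i + s) F) !telescoping_tail//.
rewrite exprD; have := shifted_value; set u := b ^+ s => E.
have -> : top_factor / k%:R * b ^+ i +
    (k%:R - 1) * (top_factor / k%:R * (b ^+ i * u)) =
  top_factor / k%:R * b ^+ i * (1 + (k%:R - 1) * u) by ring.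
rewrite E.
rewrite -qaE.
have -> : C / q * q ^+ i * (k%:R^-1 * a ^+ i * (p - p / C)) =
    (q ^+ i * a ^+ i * (C - 1) / (k%:R * q)) * p.
  by field; rewrite !gt_eqF.
have -> : top_factor / k%:R * (q ^+ i * a ^+ i) * (1 + ((p - 1) * C - p)) =
    (q ^+ i * a ^+ i * (C - 1) / (k%:R * q)) * (top_factor * q * (p - 1)).
  by field; rewrite !gt_eqF.
rewrite ler_wpM2l ?top_factor_ge//.
rewrite divr_ge0 ?mulr_ge0 ?exprn_ge0//; have := a01; lra.
Qed.

End atom_sums.

Let qpa m : (q ^+ m) `^ p * a ^+ m = 1.
Proof.
move: (p1) (q1) => p1' q1'.
rewrite -powR_exprn; last by lra.
rewrite -exprMn.
rewrite /a -powRM; [|lra|have := y01; lra].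
by rewrite divff ?powR1 ?expr1n// gt_eqF//; lra.
Qed.

(** (q^m)^p cancels the decay of the masses, so every level contributes equally. *)
Lemma sum_value_powR : \sum_(x : 'I_k * 'I_N.+1)
    level_value x.2 `^ p * level_mass x.2 =
  N%:R * (1 - a) + top_factor `^ p.
Proof.
move: (p1) (q1) => p1' q1'.
have t0 := top_factor_gt0.
rewrite -(pair_big_dep xpredT (fun _ (m : 'I_N.+1) => true)
   (fun _ (m : 'I_N.+1) => level_value m `^ p * level_mass m))/=.
rewrite sumr_const card_ord big_ord_recr/= /level_value /level_mass ltnn.
rewrite (eq_bigr (fun=> k%:R^-1 * (1 - a))); last first.
  move=> m _; rewrite ltn_ord mulrCA mulrBr exprS mulrCA qpa; ring.
rewrite sumr_const card_ord powRM ?exprn_ge0//; [|lra|lra].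
rewrite -[LHS]mulr_natr -[X in X + _]mulr_natr.
have -> : top_factor `^ p * (q ^+ N) `^ p * (k%:R^-1 * a ^+ N) =
  top_factor `^ p * k%:R^-1 * ((q ^+ N) `^ p * a ^+ N) by ring.
by rewrite qpa; field; rewrite gt_eqF.
Qed.

Lemma sum_lower_powR (c : R) : 0 <= c -> \sum_(x : 'I_k * 'I_N.+1)
    (if (x.2 < n)%N then c * q ^+ x.2 else 0) `^ p * level_mass x.2 =
  c `^ p * (n%:R * (1 - a)).
Proof.
move: (p1) (q1) => p1' q1'.
move=> c0.
rewrite -(pair_big_dep xpredT (fun _ (m : 'I_N.+1) => true)
   (fun _ (m : 'I_N.+1) =>
     (if (m < n)%N then c * q ^+ m else 0) `^ p * level_mass m))/=.
rewrite sumr_const card_ord.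
rewrite -(big_mkord xpredT (fun m =>
     (if (m < n)%N then c * q ^+ m else 0) `^ p * level_mass m)).
have nN : (n <= N.+1)%N by exact: leqW (leq_addl _ _).
rewrite (big_cat_nat _ nN)//= [X in _ + X]big1_seq ?addr0; last first.
  move=> m /andP[_]; rewrite mem_index_iota => /andP[nm _].
  by rewrite ltnNge nm/= powR0 ?mul0r//; apply/eqP; lra.
rewrite big_mkord (eq_bigr (fun=> c `^ p * (k%:R^-1 * (1 - a)))); last first.
  move=> m _; rewrite ltn_ord /level_mass ifT; last exact: leq_trans (ltn_ord m) (leq_addl _ _).
  rewrite powRM ?exprn_ge0//; last by lra.
  rewrite -mulrA; congr (_ * _); rewrite mulrCA mulrBr exprS mulrCA qpa; ring.
rewrite sumr_const card_ord -[LHS]mulr_natr -[X in X * _]mulr_natr.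
by field; rewrite gt_eqF.
Qed.

End geometric_levels.

(** * Sharpness *)

Lemma Lfun_of_finite_powR_integral d (T : measurableType d) (R : realType)
    (P : probability T R) (p c : R) (f : T -> R) :
  measurable_fun [set: T] f ->
  (\int[P]_w (`|f w| `^ p)%:E = c%:E)%E -> f \in Lfun P p%:E.
Proof.
move=> mf fc; rewrite inE; apply/andP; split; rewrite inE//=.
by rewrite /finite_norm unlock /Lnorm/= fc poweR_EFin ltry.
Qed.

(** The filtrations are generated by the atoms of [atom_mean_ge]; a point of column
    j and level i < n lies in the i-th atom of the j-th filtration. *)
Lemma filtration_with_large_maximal_function d (T : measurableType d)
    (R : realType) (P : probability T R) (p C q : R) (k s n : nat) :
  nonatomic P -> 1 < p -> 1 < C -> (1 <= k)%N -> 1 < q ->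
  (p - 1) * C `^ p - p * C `^ (p - 1) - (k%:R - 1) = 0 -> q ^+ s = C ->
  exists (G : 'I_n -> 'I_k -> set_system T) (xi : T -> R),
    [/\ filtration_family G, measurable_fun [set: T] xi,
       (\int[P]_w (`|xi w| `^ p)%:E =
         ((s + n)%:R * (1 - q^-1 `^ p) + top_factor p q `^ p)%:E)%E &
       (((C / q) `^ p * (n%:R * (1 - q^-1 `^ p)))%:E <=
         \int[P]_w (`|maximal_function P G xi w| `^ p)%:E)%E].
Proof.
move=> hP p1 C1 k1 q1 root qsC.
have C0 : 0 < C by lra.
have q0 : 0 < q by lra.
pose N := (s + n)%N; pose I := ('I_k * 'I_N.+1)%type.
pose w (x : I) := level_mass p q k s n x.2.
pose v (x : I) := level_value p q s n x.2.
have w0 x : 0 <= w x by exact: level_mass_ge0.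
have v0 x : 0 <= v x by exact: level_value_ge0.
have [B [mB tB PB]] : exists B : I -> set T,
    [/\ forall x, measurable (B x), trivIset [set: I] B &
        forall x, P (B x) = (w x)%:E].
  by apply: nonatomic_disjoint_finfamily => //; rewrite sum_level_mass.
pose S (i : nat) (j : 'I_k) (x : I) := ((if x.1 == j then i else i + s) <= x.2)%N.
pose A i j := cells B (S i j).
have mA i j : measurable (A i j) by exact: measurable_cells.
pose G (i : 'I_n) j := atom_sigma (A i j).
have fG : filtration_family G.
  split=> [i j|j i1 i2 i12]; first exact: atom_sigma_sub_sigma.
  apply: atom_sigma_anti => y [x Sx Bx]; exists x => //; apply: leq_trans Sx.
  by case: ifP => _; rewrite ?leq_add2r.
pose xi := step_fun B v.
have xi0 y : 0 <= xi y by exact: step_fun_ge0.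
have mxi : measurable_fun [set: T] xi by exact: measurable_step_fun.
have p0 : p != 0 by rewrite gt_eqF//; lra.
have int_pow (u : I -> R) : (forall x, 0 <= u x) ->
    (\int[P]_y (step_fun B u y `^ p)%:E = (\sum_x u x `^ p * w x)%:E)%E.
  move=> u0; under eq_integral => y _.
    rewrite (step_fun_comp tB (f := fun t => t `^ p)) ?powR0//; over.
  rewrite integral_step_fun//; last by move=> x; exact: powR_ge0.
  by rewrite -sumEFin; apply: eq_bigr => x _; rewrite setIT PB EFinM.
have xi_pow : (\int[P]_y (`|xi y| `^ p)%:E =
    ((s + n)%:R * (1 - q^-1 `^ p) + top_factor p q `^ p)%:E)%E.
  under eq_integral do rewrite ger0_norm//.
  by rewrite int_pow// sum_value_powR.
exists G, xi; split => //.
have xiLp : xi \in Lfun P p%:E by exact: Lfun_of_finite_powR_integral xi_pow.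
have intxi := Lfun_integrable_gt1 p1 xiLp.
pose r := C / q.
have r0 : 0 <= r by rewrite divr_ge0// ltW.
(* A lower bound for the maximal function, carried by the levels m < n. *)
pose u (x : I) := if (x.2 < n)%N then r * q ^+ x.2 else 0.
have u0 x : 0 <= u x by rewrite /u; case: ifP => // _; rewrite mulr_ge0 ?exprn_ge0// ltW.
have M_ge y : step_fun B u y <= maximal_function P G xi y.
  have M0 : 0 <= maximal_function P G xi y by exact: maximal_function_ge0.
  have [[[j m] Bx]|nB] := pselect (exists x, B x y); last first.
    by rewrite step_fun_out// => x Bx; apply: nB; exists x.
  rewrite (step_funE tB _ Bx) /u/=; case: ifPn => // mn.
  pose i := Ordinal mn.
  have Ay : A i j y by exists (j, m) => //; rewrite /S/= eqxx.
  pose Y := condexp P (G i j) xi.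
  have YP : is_condexp P (G i j) xi Y by apply: condexpP => //; case: fG.
  have := condexp_on_atom (mA i j) YP Ay.
  rewrite integral_step_fun_cells// measure_cells//.
  under eq_bigr do rewrite PB.
  under [RHS]eq_bigr do rewrite PB -EFinM.
  rewrite !sumEFin -EFinM => -[YE].
  have Ypos : r * q ^+ m <= Y y.
    have mean := atom_mean_ge p1 C1 k1 q1 root qsC j mn.
    have pos := atom_mass_gt0 p1 C1 k1 q1 root qsC j mn.
    by rewrite -(ler_pM2r pos); move: mean; rewrite -YE.
  apply: le_trans Ypos (le_trans (ler_norm _) _).
  apply: le_trans (le_bigmax _ _ i); exact: le_bigmax.
have mM : measurable_fun [set: T] (maximal_function P G xi).
  exact: measurable_maximal_function.
rewrite -(@sum_lower_powR R p q k s n)//.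
rewrite -int_pow//.
apply: ge0_le_integral => //.
- by move=> y _; rewrite lee_fin powR_ge0.
- apply/measurable_EFinP; apply: (measurableT_comp (measurable_powR p)).
  exact: measurable_step_fun.
- apply/measurable_EFinP; apply: (measurableT_comp (measurable_powR p)).
  exact: measurableT_comp.
- move=> y _; rewrite lee_fin ger0_norm; last exact: maximal_function_ge0.
  apply: ge0_ler_powR; rewrite ?nnegrE ?maximal_function_ge0 ?step_fun_ge0//.
  lra.
Qed.

(** Bernoulli's inequality shows that the s-th root of C is at most 1 + e once
    s e >= C. *)
Lemma exp_root_near_one (R : realType) (C e : R) : 1 < C -> 0 < e ->
  exists (s : nat) (q : R), [/\ 1 < q, q <= 1 + e & q ^+ s = C].
Proof.
move=> C1 e0.
have bernoulli (s : nat) : 1 + s%:R * e <= (1 + e) ^+ s.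
  elim: s => [|s IH]; first by rewrite mul0r addr0 expr0.
  rewrite exprS -natr1.
  have : (1 + e) * (1 + s%:R * e) <= (1 + e) * (1 + e) ^+ s.
    by rewrite ler_wpM2l//; lra.
  have : 0 <= s%:R * (e * e) by rewrite !mulr_ge0//; lra.
  by set x := s%:R; lra.
pose s := Num.bound (C / e).
have Cs : C / e < s%:R by apply: archi_boundP; rewrite divr_ge0//; lra.
have s0 : (0 : R) < s%:R by apply: lt_trans Cs; rewrite divr_gt0//; lra.
have sn : s%:R != 0 :> R by rewrite gt_eqF.
exists s, (C `^ s%:R^-1).
have q0 : 0 <= C `^ s%:R^-1 by exact: powR_ge0.
have qs : (C `^ s%:R^-1) ^+ s = C.
  by rewrite -powR_mulrn// -powRrM mulVf// powRr1//; lra.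
have s_gt0 : (0 < s)%N by rewrite -(ltr0n R).
split => //.
  by rewrite -(@ltr_pXn2r _ s)// ?nnegrE// qs expr1n.
rewrite -(@ler_pXn2r _ s)// ?nnegrE//; last by lra.
rewrite qs; apply: le_trans (bernoulli s).
by move: Cs; rewrite ltr_pdivrMr//; lra.
Qed.

(** First q is taken so close to 1 that C / q exceeds th = max(0, C - eps); then n
    is so large that the n good levels outweigh the s + 1 others. *)
Lemma maximal_Lnorm_sharp d (T : measurableType d) (R : realType)
    (P : probability T R) (p C eps : R) (k : nat) :
  nonatomic P -> 1 < p -> 1 < C -> (1 <= k)%N -> 0 < eps ->
  (p - 1) * C `^ p - p * C `^ (p - 1) - (k%:R - 1) = 0 ->
  exists (n : nat) (G : 'I_n -> 'I_k -> set_system T) (xi : T -> R),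
    [/\ (1 <= n)%N, filtration_family G, xi \in Lfun P p%:E &
       ('N[P]_p%:E[EFin \o maximal_function P G xi] >
         (C - eps)%:E * 'N[P]_p%:E[EFin \o xi])%E].
Proof.
move=> hP p1 C1 k1 eps0 root.
(* C - eps may be negative, where real powers are not monotone. *)
pose th := Num.max 0 (C - eps).
have th0 : 0 <= th by rewrite le_max lexx.
have thC : th < C by rewrite gt_max; apply/andP; split; lra.
have the : C - eps <= th by rewrite le_max lexx orbT.
have [s [q [q1 qe qsC]]] : exists (s : nat) (q : R),
    [/\ 1 < q, q <= 1 + (C - th) / (2 * C) & q ^+ s = C].
  by apply: exp_root_near_one => //; rewrite divr_gt0 ?mulr_gt0//; lra.
have q0 : 0 < q by lra.
have thr : th < C / q.
  rewrite ltr_pdivlMr//; apply: (@le_lt_trans _ _ (th * (1 + (C - th) / (2 * C)))).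
    by rewrite ler_wpM2l.
  have [->|t0] := eqVneq th 0; first by lra.
  have tC : th / C < 1 by rewrite ltr_pdivrMr; lra.
  have -> : th * (1 + (C - th) / (2 * C)) = th + (C - th) * (th / C / 2).
    by field; lra.
  have : (C - th) * (th / C / 2) < (C - th) * 1 by rewrite ltr_pM2l; lra.
  lra.
pose r := C / q; pose a := q^-1 `^ p.
have y01 : 0 < q^-1 < 1 by rewrite invr_gt0 q0 invf_lt1.
have a1 : a < 1.
  have : q^-1 `^ p < 1 `^ p by apply: gt0_ltr_powR; rewrite ?nnegrE; lra.
  by rewrite powR1.
have rth : th `^ p < r `^ p.
  by apply: gt0_ltr_powR; rewrite ?nnegrE ?(le_trans th0 (ltW thr))//; lra.
pose K := th `^ p * (s%:R * (1 - a) + top_factor p q `^ p).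
have K0 : 0 <= K.
  rewrite mulr_ge0 ?powR_ge0// addr_ge0 ?powR_ge0// mulr_ge0//; lra.
have den0 : 0 < (r `^ p - th `^ p) * (1 - a) by rewrite mulr_gt0; lra.
(* n is chosen from th^p (s (1-a) + top^p) < (r^p - th^p) (1-a) n. *)
pose n := (Num.bound (K / ((r `^ p - th `^ p) * (1 - a)))).+1.
have Kn : K < (r `^ p - th `^ p) * (1 - a) * n%:R.
  rewrite mulrC -ltr_pdivrMr// /n -natr1 ltr_wpDr//.
  by apply: archi_boundP; rewrite divr_ge0// ltW.
have [G [xi [fG mxi xi_pow M_pow]]] :=
  filtration_with_large_maximal_function n hP p1 C1 k1 q1 root qsC.
have xiLp : xi \in Lfun P p%:E by exact: Lfun_of_finite_powR_integral xi_pow.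
exists n, G, xi; split => //.
set I0 := (s + n)%:R * (1 - q^-1 `^ p) + top_factor p q `^ p in xi_pow.
set J0 := (C / q) `^ p * (n%:R * (1 - q^-1 `^ p)) in M_pow.
have I00 : 0 <= I0.
  rewrite /I0 -/a addr_ge0 ?powR_ge0// mulr_ge0//; lra.
have IJ : th `^ p * I0 < J0.
  have -> : th `^ p * I0 = K + th `^ p * ((1 - a) * n%:R).
    by rewrite /I0 /K -/a natrD; ring.
  have -> : J0 = (r `^ p - th `^ p) * (1 - a) * n%:R + th `^ p * ((1 - a) * n%:R).
    by rewrite /J0 -/a -/r; ring.
  by rewrite ltrD2r.
have pV : 0 < p^-1 by rewrite invr_gt0; lra.
have pn0 : p != 0 by rewrite gt_eqF//; lra.
rewrite unlock /Lnorm/= xi_pow poweR_EFin -EFinM.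
apply: (@le_lt_trans _ _ ((th `^ p * I0) `^ p^-1)%:E).
  rewrite lee_fin powRM ?powR_ge0// -powRrM divff// powRr1//.
  by rewrite ler_wpM2r// powR_ge0.
apply: (@lt_le_trans _ _ (J0 `^ p^-1)%:E).
  have tI0 : 0 <= th `^ p * I0 by rewrite mulr_ge0 ?powR_ge0.
  by rewrite lte_fin; apply: gt0_ltr_powR => //; rewrite nnegrE ltW// (le_lt_trans tI0).
rewrite -poweR_EFin; apply: gt0_ler_poweR; rewrite ?in_itv/= ?leey ?andbT//.
- exact: ltW.
- by rewrite lee_fin ltW// (le_lt_trans _ IJ)// mulr_ge0 ?powR_ge0.
- by apply: integral_ge0 => y _; rewrite lee_fin powR_ge0.
Qed.

(** * The sharp maximal inequality *)

Theorem theorem1p1 (R : realType) (d : measure_display) (T : measurableType d)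
    (P : probability T R) (hP : nonatomic P)
    (p : R) (hp : 1 < p) (k : nat) (hk : (1 <= k)%N) :
  exists C : R,
    [/\ unique (fun c : R =>
          1 <= c /\ (p - 1) * c `^ p - p * c `^ (p - 1) - (k%:R - 1) = 0) C,
        forall (n : nat) (G : 'I_n -> 'I_k -> set_system T) (xi : T -> R),
          (1 <= n)%N -> filtration_family G -> xi \in Lfun P p%:E ->
          ('N[P]_(p%:E)[EFin \o maximal_function P G xi]
             <= C%:E * 'N[P]_(p%:E)[EFin \o xi])%E &
        forall eps : R, 0 < eps ->
          exists (n : nat) (G : 'I_n -> 'I_k -> set_system T) (xi : T -> R),
            [/\ (1 <= n)%N, filtration_family G, xi \in Lfun P p%:E &
              ('N[P]_(p%:E)[EFin \o maximal_function P G xi]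
                 > (C - eps)%:E * 'N[P]_(p%:E)[EFin \o xi])%E]].
Proof.
have k1 : (0 : R) <= k%:R - 1 by rewrite subr_ge0 ler1n.
have [C C1 root] := extremal_root_exists hp k1.
have {}C1' := extremal_root_gt1 hk C1 root.
exists C; split.
- split=> [//|c [c1 rootc]].
  exact: extremal_root_unique hp k1 C1 c1 root rootc.
- by move=> n G xi n1 fG xiLp; exact: maximal_Lnorm_le.
- by move=> eps eps0; exact: maximal_Lnorm_sharp.
Qed.
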